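(* Let $\alpha\ge 0$, $\gamma>0$, $0\le\xi\le 1$, let $\mu>0$, $\nu>0$ satisfy $\mu+\nu=\alpha-\gamma$ and $\mu\nu=\gamma$, and let $\lambda:[0,1]\to\mathbb{R}$ be a non-negative integrable function with $\int_0^1\lambda(t)\,dt=1$. Let $\rho<1$ and $\beta<1$ satisfy $$\frac{1}{2(1-\beta)(1-\rho)}=\int_0^1\lambda(t)\left[(1-\xi)\left(\frac{1-g(t)}{2}\right)+\xi(1-q(t))\right]dt .$$ For $f\in\mathcal{A}$ define $$\mathcal{V}_\lambda(f)(z)=\left(z\int_0^1\lambda(t)\,\frac{1-\rho tz}{1-tz}\,dt\right)\ast f(z).$$ For $|\epsilon|=1$ put $h(z)=h_\epsilon(z)=\dfrac{z\left(1+\frac{\epsilon-1}{2}z\right)}{(1-z)^2}$ and $$N_{\Pi_{\mu,\nu}}(h)=\inf_{z\in\mathbb{D}}\int_0^1 t^{1/\mu-1}\,\Pi_{\mu,\nu}(t)\left[(1-\xi)\left(\mathrm{Re}\,\frac{h(tz)}{tz}-\frac{1}{(1+t)^2}\right)+\xi\left(\mathrm{Re}\,h'(tz)-\frac{1-t}{(1+t)^3}\right)\right]dt .$$ Then $\mathcal{V}_\lambda(W_\beta(\alpha,\gamma))\subset M(\xi)$ if and only if $N_{\Pi_{\mu,\nu}}(h_\epsilon)\ge0$ for all $\epsilon$ with $|\epsilon|=1$.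
   Context: $\mathbb{D}=\{z\in\mathbb{C}:|z|<1\}$. $\mathcal{A}$ is the class of analytic functions $f$ in $\mathbb{D}$ with $f(0)=f'(0)-1=0$. The Hadamard product (convolution) of $\sum a_kz^k$ and $\sum b_kz^k$ is $\sum a_kb_kz^k$, denoted $\ast$. For $0\le\xi\le1$, the Pascu class $M(\xi)$ consists of the $f\in\mathcal{A}$ with $\mathrm{Re}\,\dfrac{\xi z(zf'(z))'+(1-\xi)zf'(z)}{\xi zf'(z)+(1-\xi)f(z)}>0$ in $\mathbb{D}$, i.e. $\xi zf'+(1-\xi)f$ is starlike with respect to the origin. For $\alpha\ge0,\gamma\ge0,\beta<1$, $W_\beta(\alpha,\gamma)$ is the class of $f\in\mathcal{A}$ for which there is $\phi\in\mathbb{R}$ with $\mathrm{Re}\left(e^{i\phi}\left((1-\alpha+2\gamma)\frac{f(z)}{z}+(\alpha-2\gamma)f'(z)+\gamma zf''(z)-\beta\right)\right)>0$ for all $z\in\mathbb{D}$. $\Lambda_\nu(t)=\int_t^1\frac{\lambda(x)}{x^{1/\nu}}\,dx$ and $\Pi_{\mu,\nu}(t)=\int_t^1\Lambda_\nu(x)\,x^{1/\nu-1-1/\mu}\,dx$. For $0\le t<1$, $g(t)=2\sum_{n=0}^\infty\frac{(n+1)(-1)^nt^n}{(1+\mu n)(1+\nu n)}-1$ and $q(t)=\sum_{n=0}^\infty\frac{(n+1)^2(-1)^nt^n}{(1+\mu n)(1+\nu n)}$. *)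

(* Defs.v *)
From HB Require Import structures.
From mathcomp Require Import all_boot all_order all_algebra.
From mathcomp Require Import complex.
From mathcomp Require Import all_classical all_reals all_analysis.

Set Implicit Arguments.
Unset Strict Implicit.
Unset Printing Implicit Defensive.

Import Order.TTheory GRing.Theory Num.Theory.
Import numFieldNormedType.Exports.

Local Open Scope classical_set_scope.
Local Open Scope ring_scope.

(* The complex numbers over R.  Typing them as a numFieldType (rather than
   using the bare type R[i]) is what gives them the library's topology, limits
   and derivatives; [derive1] on [Cplx R -> Cplx R] is the complex derivative. *)
Definition Cplx (R : realType) : numFieldType := (complex R : numFieldType).

Definition ofR (R : realType) (x : R) : Cplx R := Complex x 0.

Definition expi (R : realType) (x : R) : Cplx R := Complex (cos x) (sin x).

(* Functions on the unit disk are total functions whose values off the disk are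
   never used.  Analyticity is stated through the power series about the
   origin, converging on the whole disk, on which the Hadamard product acts. *)
Definition analytic_in_disk (R : realType) (f : Cplx R -> Cplx R) : Prop :=
  exists a : nat -> Cplx R, forall z : Cplx R, `|z| < 1 ->
    series (fun k => a k * z ^+ k) @ \oo --> f z.

Definition classA (R : realType) (f : Cplx R -> Cplx R) : Prop :=
  [/\ analytic_in_disk f, f 0 = 0 & derive1 f 0 = 1].

Definition taylor_coef (R : realType) (f : Cplx R -> Cplx R) (k : nat)
    : Cplx R :=
  derive1n k f 0 / k`!%:R.

Definition hadamard (R : realType) (f g : Cplx R -> Cplx R) (z : Cplx R)
    : Cplx R :=
  limn (series (fun k => taylor_coef f k * taylor_coef g k * z ^+ k)).

(* The function f(z)/z for f with f(0) = 0, with its removable singularity at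
   the origin removed. *)
Definition overz (R : realType) (f : Cplx R -> Cplx R) (z : Cplx R) : Cplx R :=
  if z == 0 then derive1 f 0 else f z / z.

Definition cintegral (R : realType) (D : set R) (f : R -> Cplx R) : Cplx R :=
  Complex (\int[lebesgue_measure]_(t in D) complex.Re (f t))
          (\int[lebesgue_measure]_(t in D) complex.Im (f t)).

(* At z = 0 the quotient is understood as its limit 1, so only z != 0 has to be
   required.  Since x / 0 = 0, the strict inequality also forces the
   denominator not to vanish. *)
Definition pascu (R : realType) (xi : R) (f : Cplx R -> Cplx R) : Prop :=
  classA f /\
  forall z : Cplx R, `|z| < 1 -> z != 0 ->
    0 < complex.Re
      ((ofR xi * z * derive1 (fun w => w * derive1 f w) z
          + ofR (1 - xi) * z * derive1 f z)
       / (ofR xi * z * derive1 f z + ofR (1 - xi) * f z)).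

Definition classW (R : realType) (beta alpha gamma : R)
    (f : Cplx R -> Cplx R) : Prop :=
  classA f /\
  exists phi : R, forall z : Cplx R, `|z| < 1 ->
    0 < complex.Re
      (expi phi *
       (ofR (1 - alpha + 2 * gamma) * overz f z
          + ofR (alpha - 2 * gamma) * derive1 f z
          + ofR gamma * z * derive1 (derive1 f) z
          - ofR beta)).

Definition Lambda (R : realType) (lam : R -> R) (nu t : R) : R :=
  \int[lebesgue_measure]_(x in `[t, 1]) (lam x / (x `^ nu^-1)).

Definition Pi (R : realType) (lam : R -> R) (mu nu t : R) : R :=
  \int[lebesgue_measure]_(x in `[t, 1])
    (Lambda lam nu x * x `^ (nu^-1 - 1 - mu^-1)).

(* The two series below converge for 0 <= t < 1; their values at t = 1 are not
   meaningful, and only enter integrals over [0, 1], where they do not count. *)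
Definition gfun (R : realType) (mu nu t : R) : R :=
  2 * limn (series (fun n : nat =>
        n.+1%:R * (-1) ^+ n * t ^+ n / ((1 + mu * n%:R) * (1 + nu * n%:R))))
  - 1.

Definition qfun (R : realType) (mu nu t : R) : R :=
  limn (series (fun n : nat =>
    n.+1%:R ^+ 2 * (-1) ^+ n * t ^+ n / ((1 + mu * n%:R) * (1 + nu * n%:R)))).

Definition Vop (R : realType) (lam : R -> R) (rho : R)
    (f : Cplx R -> Cplx R) : Cplx R -> Cplx R :=
  hadamard
    (fun z => z * cintegral `[0, 1] (fun t =>
       ofR (lam t) * ((1 - ofR (rho * t) * z) / (1 - ofR t * z))))
    f.

Definition heps (R : realType) (eps z : Cplx R) : Cplx R :=
  z * (1 + (eps - 1) / 2%:R * z) / (1 - z) ^+ 2.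

(* The infimum is taken in the extended reals: it is -oo when the integrals are
   not bounded below, whereas the library's real [inf] would then be 0. *)
Definition Nfun (R : realType) (lam : R -> R) (mu nu xi : R)
    (h : Cplx R -> Cplx R) : \bar R :=
  ereal_inf [set (\int[lebesgue_measure]_(t in `[0%R, 1%R])
    (t `^ (mu^-1 - 1) * Pi lam mu nu t *
      ((1 - xi) * (complex.Re (overz h (ofR t * z)) - 1 / (1 + t) ^+ 2)
       + xi * (complex.Re (derive1 h (ofR t * z))
                - (1 - t) / (1 + t) ^+ 3)))%:E)%E
    | z in [set z : Cplx R | `|z| < 1]].

(* Main.v *)
Require Import Defs.
From HB Require Import structures.
From mathcomp Require Import all_boot all_order all_algebra.
From mathcomp Require Import complex.
From mathcomp Require Import all_classical all_reals all_analysis.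
From mathcomp Require Import measurable_realfun.
From mathcomp Require Import zify ring lra.
Set Implicit Arguments.
Unset Strict Implicit.
Unset Printing Implicit Defensive.
Import Order.TTheory GRing.Theory Num.Theory.
Import numFieldNormedType.Exports.
Local Open Scope classical_set_scope.
Local Open Scope ring_scope.

(** Write f(z) = z + a_2 z^2 + ..., tau_n for the n-th moment of lambda,
    c_n = 1 + (1+eps)/2 n for the coefficients of h_eps(z)/z,
    B = 1/(2(1-beta)(1-rho)), and
    k_n = tau_n (1 + xi n) c_n / ((1 + mu n)(1 + nu n)).
    Both sides of the equivalence say that Re K(z) >= B on the disk, for all eps,
    where K has the coefficients k_n for n > 0 and the constant term 2B.

    For the class W.  The differential expression defining W multiplies a_(n+1)
    by (1 + mu n)(1 + nu n); normalized, it is a series P with P(0) = 1 and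
    exp(i phi) P of positive real part ([classW_ps], [classW_carath_coef]).  The
    image of f belongs to the Pascu class if and only if the convolution of
    xi z F' + (1 - xi) F with every h_eps has no zero but the origin
    ([starlike_crit]), and this convolution is z times 1/(2B) times the Hadamard
    product K * P ([pascu_V]).  So the question is when K * P has no zero for
    every such P.  If Re K >= B = K(0)/2, then K * P is an average of rotations
    of P with nonnegative weights 2 (Re K - B), and exp(i phi) K * P has positive
    real part ([convolution_Re_ge0], [harnack], [dual_halfplane_pascu]).
    Otherwise Re K takes the value B somewhere, and a Moebius transformation P of
    the disk onto a half-plane makes K * P vanish there
    ([pascu_dual_halfplane]).  The averages are taken over roots of unity rather
    than over the circle; they are exact for truncated series.

    For N.  By Tonelli's theorem, applied to the two nested tail integrals, the
    n-th moment of t^(1/mu-1) Pi(t) is mu nu tau_n/((1 + mu n)(1 + nu n))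
    ([kappa_moment]).  Integrating h(tz)/(tz) and h'(tz) termwise therefore
    produces the series of the k_n.  The two subtracted terms are power series in
    -t which are only Abel summable at t = 1; letting the radius tend to 1 under
    the integral sign turns their integral into that of the series g and q
    against lambda, which the definition of beta makes equal to mu nu (1 - B)
    ([integral_kappa_lam], [normalization_integral]).  The integral in N is thus
    mu nu (Re K(z) - B) ([Nfun_integral]). *)

(** * The complex modulus and complex limits *)

(** The modulus as a real number: the norm of [Cplx R] takes complex values. *)
HB.lock Definition cabs (R : realType) (z : Cplx R) : R :=
  ComplexField.Normc.normc z.

Section Modulus.
Variable R : realType.
Implicit Types (z w : Cplx R) (x y : R).

Lemma normE z : `|z| = ofR (cabs z).
Proof. by rewrite cabs.unlock. Qed.

Lemma ofR_inj : injective (@ofR R).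
Proof. by move=> x y []. Qed.

Lemma ofR0 : ofR (0 : R) = 0. Proof. by []. Qed.
Lemma ofR1 : ofR (1 : R) = 1. Proof. by []. Qed.
Lemma ofRD x y : ofR (x + y) = ofR x + ofR y.
Proof. exact: (rmorphD (real_complex R)). Qed.
Lemma ofRN x : ofR (- x) = - ofR x.
Proof. exact: (rmorphN (real_complex R)). Qed.
Lemma ofRB x y : ofR (x - y) = ofR x - ofR y.
Proof. exact: (rmorphB (real_complex R)). Qed.
Lemma ofRM x y : ofR (x * y) = ofR x * ofR y.
Proof. exact: (rmorphM (real_complex R)). Qed.
Lemma ofRV x : ofR (x^-1) = (ofR x)^-1.
Proof. exact: (fmorphV (real_complex R)). Qed.
Lemma ofRX x n : ofR (x ^+ n) = ofR x ^+ n.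
Proof. exact: (rmorphXn (real_complex R)). Qed.
Lemma ofR_nat n : ofR (n%:R : R) = n%:R.
Proof. exact: (rmorph_nat (real_complex R)). Qed.

Lemma ltR_norm z (x : R) : (`|z| < ofR x) = (cabs z < x).
Proof. by rewrite normE; exact: ltcR. Qed.
Lemma ltR_norm1 z : (`|z| < 1) = (cabs z < 1).
Proof. exact: ltR_norm. Qed.

Lemma cabs_ge0 z : 0 <= cabs z.
Proof. by rewrite cabs.unlock; case: z => a b; rewrite sqrtr_ge0. Qed.
Lemma cabsM z w : cabs (z * w) = cabs z * cabs w.
Proof. by apply: ofR_inj; rewrite ofRM -!normE normrM. Qed.
Lemma cabs0 : cabs (0 : Cplx R) = 0.
Proof. by apply: ofR_inj; rewrite -normE normr0. Qed.
Lemma cabs1 : cabs (1 : Cplx R) = 1.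
Proof. by apply: ofR_inj; rewrite -normE normr1. Qed.
Lemma cabsN z : cabs (- z) = cabs z.
Proof. by apply: ofR_inj; rewrite -!normE normrN. Qed.
Lemma cabsB z w : cabs (z - w) = cabs (w - z).
Proof. by rewrite -cabsN opprB. Qed.
Lemma cabsX z n : cabs (z ^+ n) = cabs z ^+ n.
Proof. by apply: ofR_inj; rewrite ofRX -!normE normrX. Qed.
Lemma cabsV z : cabs (z^-1) = (cabs z)^-1.
Proof. by apply: ofR_inj; rewrite ofRV -!normE normfV. Qed.
Lemma cabs_eq0 z : (cabs z == 0) = (z == 0).
Proof.
by rewrite -(inj_eq ofR_inj) -normE ofR0 normr_eq0.
Qed.
Lemma cabs_gt0 z : (0 < cabs z) = (z != 0).
Proof. by rewrite lt_def cabs_eq0 cabs_ge0 andbT. Qed.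
Lemma cabsD z w : cabs (z + w) <= cabs z + cabs w.
Proof.
have := ler_normD z w; rewrite !normE -ofRD => h.
by rewrite -lecR.
Qed.
Lemma cabs_ofR x : cabs (ofR x) = `|x|.
Proof. by rewrite cabs.unlock /= expr0n /= addr0 sqrtr_sqr. Qed.
Lemma cabs_nat n : cabs (n%:R : Cplx R) = n%:R.
Proof. by rewrite -ofR_nat cabs_ofR ger0_norm. Qed.

Lemma le_Re_cabs z : `|complex.Re z| <= cabs z.
Proof. by have := normc_ge_Re z; rewrite normE -lecR. Qed.
Lemma le_Im_cabs z : `|complex.Im z| <= cabs z.
Proof.
rewrite -sqrtr_sqr cabs.unlock; case: z => a b /=.
by rewrite ler_wsqrtr // lerDr sqr_ge0.
Qed.
Lemma cabs_le z : cabs z <= `|complex.Re z| + `|complex.Im z|.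
Proof.
have -> : z = ofR (complex.Re z) + ofR (complex.Im z) * (Complex 0 1).
  by case: z => a b; rewrite /ofR; simpc.
apply: le_trans (cabsD _ _) _.
rewrite cabsM !cabs_ofR (_ : cabs (Complex 0 1) = 1) ?mulr1; last first.
  by rewrite cabs.unlock /= expr0n /= add0r expr1n sqrtr1.
case: z => a b /=; rewrite /ofR.
by rewrite !(mulr0, mul0r, mulr1, mul1r, addr0, add0r, subr0, oppr0).
Qed.

Lemma cabs_sum (I : Type) (s : seq I) (F : I -> Cplx R) :
  cabs (\sum_(i <- s) F i) <= \sum_(i <- s) cabs (F i).
Proof.
elim/big_rec2: _ => [|i x z _ h]; first by rewrite cabs0.
by apply: le_trans (cabsD _ _) _; rewrite lerD2l.
Qed.

Lemma ReD z w : complex.Re (z + w) = complex.Re z + complex.Re w.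
Proof. by case: z w => [a b] [c d]. Qed.
Lemma ImD z w : complex.Im (z + w) = complex.Im z + complex.Im w.
Proof. by case: z w => [a b] [c d]. Qed.
Lemma ReN z : complex.Re (- z) = - complex.Re z.
Proof. by case: z. Qed.
Lemma ImN z : complex.Im (- z) = - complex.Im z.
Proof. by case: z. Qed.
Lemma ReB z w : complex.Re (z - w) = complex.Re z - complex.Re w.
Proof. by rewrite ReD ReN. Qed.
Lemma ImB z w : complex.Im (z - w) = complex.Im z - complex.Im w.
Proof. by rewrite ImD ImN. Qed.
Lemma ReM z w : complex.Re (z * w) =
  complex.Re z * complex.Re w - complex.Im z * complex.Im w.
Proof. by case: z w => [a b] [c d]. Qed.
Lemma ImM z w : complex.Im (z * w) =
  complex.Re z * complex.Im w + complex.Im z * complex.Re w.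
Proof. by case: z w => [a b] [c d]. Qed.
Lemma ReZ x z : complex.Re (ofR x * z) = x * complex.Re z.
Proof. by rewrite ReM /= mul0r subr0. Qed.
Lemma ImZ x z : complex.Im (ofR x * z) = x * complex.Im z.
Proof. by rewrite ImM /= mul0r addr0. Qed.
Lemma Re_sum (I : Type) (s : seq I) (F : I -> Cplx R) :
  complex.Re (\sum_(i <- s) F i) = \sum_(i <- s) complex.Re (F i).
Proof. by elim/big_rec2: _ => // i x z _ <-; rewrite ReD. Qed.
Lemma Im_sum (I : Type) (s : seq I) (F : I -> Cplx R) :
  complex.Im (\sum_(i <- s) F i) = \sum_(i <- s) complex.Im (F i).
Proof. by elim/big_rec2: _ => // i x z _ <-; rewrite ImD. Qed.
Lemma eq_Cplx z w : complex.Re z = complex.Re w -> complex.Im z = complex.Im w -> z = w.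
Proof. by case: z w => [a b] [c d] /= -> ->. Qed.

Lemma cvgCP (T : Type) (F : set_system T) {FF : Filter F} (f : T -> Cplx R) (l : Cplx R) :
  f @ F --> l <-> forall e : R, 0 < e -> \forall x \near F, cabs (l - f x) < e.
Proof.
split=> [/cvgrPdist_lt h e e0|h].
  by have := h (ofR e); rewrite ltcR => /(_ e0); apply: filterS => x; rewrite ltR_norm.
apply/cvgrPdist_lt => e e0.
have [eR eI] : 0 < complex.Re e /\ e = ofR (complex.Re e).
  by case: e e0 => a b; rewrite ltcE /= => /andP[/eqP -> ?].
rewrite eI; near=> x; rewrite ltR_norm; near: x; exact: h.
Unshelve. all: by end_near.
Qed.

Lemma cvg_Re (T : Type) (F : set_system T) {FF : Filter F} (f : T -> Cplx R) (l : Cplx R) :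
  f @ F --> l -> complex.Re (f x) @[x --> F] --> complex.Re l.
Proof.
move=> /cvgCP h; apply/cvgrPdist_lt => e e0.
by apply: filterS (h e e0) => x; rewrite /= -ReB => ?; apply: le_lt_trans (le_Re_cabs _) _.
Qed.

Lemma cvg_Im (T : Type) (F : set_system T) {FF : Filter F} (f : T -> Cplx R) (l : Cplx R) :
  f @ F --> l -> complex.Im (f x) @[x --> F] --> complex.Im l.
Proof.
move=> /cvgCP h; apply/cvgrPdist_lt => e e0.
by apply: filterS (h e e0) => x; rewrite /= -ImB => ?; apply: le_lt_trans (le_Im_cabs _) _.
Qed.

Lemma cvg_ReIm (T : Type) (F : set_system T) {FF : Filter F} (f : T -> Cplx R) (l : Cplx R) :
  complex.Re (f x) @[x --> F] --> complex.Re l ->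
  complex.Im (f x) @[x --> F] --> complex.Im l -> f @ F --> l.
Proof.
move=> /cvgrPdist_lt hR /cvgrPdist_lt hI; apply/cvgCP => e e0.
have e2 : 0 < e / 2 by rewrite divr_gt0.
apply: filterS2 (hR _ e2) (hI _ e2) => x hx hy.
apply: le_lt_trans (cabs_le _) _; rewrite ReB ImB.
by have := ltrD hx hy; rewrite -splitr.
Qed.

Lemma cvg_ofR (T : Type) (F : set_system T) {FF : Filter F} (f : T -> R) (l : R) :
  f @ F --> l -> ofR (f x) @[x --> F] --> ofR l.
Proof.
move=> /cvgrPdist_lt h; apply/cvgCP => e e0.
by apply: filterS (h e e0) => x; rewrite -ofRB cabs_ofR.
Qed.

Lemma cvgC_lim (T : Type) (F : set_system T) {FF : ProperFilter F}
    (f : T -> Cplx R) (l : Cplx R) : f @ F --> l -> lim (f @ F) = l.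
Proof. by move=> h; apply/cvg_lim => //; exact: norm_hausdorff. Qed.

Lemma cvgC_unique (T : Type) (F : set_system T) {FF : ProperFilter F}
    (f : T -> Cplx R) (l l' : Cplx R) : f @ F --> l -> f @ F --> l' -> l = l'.
Proof. by move=> /cvgC_lim <- /cvgC_lim <-. Qed.

Lemma eq_cvgn (T : nbhsType) (u v : nat -> T) (l : T) :
  u =1 v -> u @ \oo --> l -> v @ \oo --> l.
Proof. by move=> /funext ->. Qed.

Lemma cvgCM (T : Type) (F : set_system T) {FF : Filter F} (f g : T -> Cplx R)
    (l k : Cplx R) : f @ F --> l -> g @ F --> k -> f x * g x @[x --> F] --> l * k.
Proof. by move=> hf hg; exact: cvgM. Qed.

Lemma cvgCD (T : Type) (F : set_system T) {FF : Filter F} (f g : T -> Cplx R)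
    (l k : Cplx R) : f @ F --> l -> g @ F --> k -> f x + g x @[x --> F] --> l + k.
Proof.
move=> hf hg; apply: cvg_ReIm.
  under eq_fun do rewrite ReD.
  by rewrite ReD; exact: (cvgD (cvg_Re hf) (cvg_Re hg)).
under eq_fun do rewrite ImD.
by rewrite ImD; exact: (cvgD (cvg_Im hf) (cvg_Im hg)).
Qed.

Lemma cvgCB (T : Type) (F : set_system T) {FF : Filter F} (f g : T -> Cplx R)
    (l k : Cplx R) : f @ F --> l -> g @ F --> k -> f x - g x @[x --> F] --> l - k.
Proof.
move=> hf hg; apply: cvg_ReIm.
  under eq_fun do rewrite ReB.
  by rewrite ReB; exact: (cvgB (cvg_Re hf) (cvg_Re hg)).
under eq_fun do rewrite ImB.
by rewrite ImB; exact: (cvgB (cvg_Im hf) (cvg_Im hg)).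
Qed.

Lemma cvgC_cst (T : Type) (F : set_system T) {FF : Filter F} (l : Cplx R) :
  (fun=> l) @ F --> l.
Proof. exact: cvg_cst. Qed.

(** The limit is built from the real and imaginary parts, each of which is
    absolutely summable; the bound on its modulus passes to the limit from the
    partial sums. *)
Lemma cseries_dom (c : nat -> Cplx R) (b : nat -> R) :
  (forall n, cabs (c n) <= b n) -> cvgn (series b) ->
  exists2 l : Cplx R, series c @ \oo --> l & cabs l <= limn (series b).
Proof.
move=> cb cvb.
have b0 n : 0 <= b n by apply: le_trans (cb n); exact: cabs_ge0.
have hR : cvgn (series (fun n => complex.Re (c n))).
  apply: normed_cvg; apply: series_le_cvg cvb; [by move=> n /=|by []|].
  by move=> n; exact: le_trans (le_Re_cabs _) (cb n).
have hI : cvgn (series (fun n => complex.Im (c n))).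
  apply: normed_cvg; apply: series_le_cvg cvb; [by move=> n /=|by []|].
  by move=> n; exact: le_trans (le_Im_cabs _) (cb n).
pose l : Cplx R := Complex (limn (series (fun n => complex.Re (c n))))
  (limn (series (fun n => complex.Im (c n)))).
have cl : series c @ \oo --> l.
  apply: cvg_ReIm; rewrite /series /=.
    by under eq_fun do rewrite Re_sum; exact: hR.
  by under eq_fun do rewrite Im_sum; exact: hI.
exists l => //.
apply/ler_addgt0Pr => e e0.
have /cvgCP/(_ e e0)[N _ /(_ N (leqnn N)) hN] := cl.
have -> : l = (l - series c N) + series c N by rewrite subrK.
apply: le_trans (cabsD _ _) _; rewrite addrC lerD // ?(ltW hN) //.
apply: le_trans (cabs_sum _ _) _.
apply: le_trans (nondecreasing_cvgn_le _ cvb N).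
  by apply: ler_sum => i _; exact: cb.
by apply: nondecreasing_series => n _ _; exact: b0.
Qed.

End Modulus.

(** * Power series on the unit disk *)

HB.lock Definition ps (R : realType) (a : nat -> Cplx R) (z : Cplx R) : Cplx R :=
  limn (series (fun k => a k * z ^+ k)).

Section PowerSeries.
Variable R : realType.
Implicit Types (a b c : nat -> Cplx R) (z w : Cplx R) (r x : R) (n : nat).

(** The Cauchy-Hadamard form of the statement that the radius of convergence is
    at least one.  Unlike convergence on the disk, it visibly survives shifts,
    polynomial factors and Hadamard products of the coefficients. *)
Definition PS a := forall r, 0 <= r < 1 -> exists M, forall n, cabs (a n) * r ^+ n <= M.

Lemma midpoint_lt1 r : 0 <= r < 1 -> [/\ 0 < (1 + r) / 2, (1 + r) / 2 < 1, r <= (1 + r) / 2 &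
  0 <= r / ((1 + r) / 2) < 1].
Proof.
move=> /andP[r0 r1]; have h : 0 < (1 + r) / 2 by lra.
split=> //; try lra.
by rewrite divr_ge0 ?(ltW h) // ltr_pdivrMr // mul1r; lra.
Qed.

Lemma geom_cvg (M r : R) : 0 <= r < 1 -> cvgn (series (fun n => M * r ^+ n)).
Proof.
by move=> /andP[r0 r1]; apply: is_cvg_geometric_series; rewrite ger0_norm.
Qed.

Lemma PS_sum a r : PS a -> 0 <= r < 1 -> cvgn (series (fun n => cabs (a n) * r ^+ n)).
Proof.
move=> ha r01; have [s0 s1 rs q01] := midpoint_lt1 r01.
set s := (1 + r) / 2 in s0 s1 rs q01.
have [|M hM] := ha s; first by rewrite s1 ltW.
have [r0 _] := andP r01.
apply: series_le_cvg (@geom_cvg M _ q01).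
- by move=> n; rewrite mulr_ge0 ?cabs_ge0 ?exprn_ge0.
- move=> n; rewrite mulr_ge0 ?exprn_ge0 //; last by case/andP: q01.
  by apply: le_trans (hM 0%N); rewrite expr0 mulr1 cabs_ge0.
- move=> n; have -> : cabs (a n) * r ^+ n = cabs (a n) * s ^+ n * (r / s) ^+ n.
    by rewrite -mulrA -exprMn [s * _]mulrC divfK // gt_eqF.
  by rewrite ler_wpM2r ?exprn_ge0 //; case/andP: q01.
Qed.

(** Each of the n+1 terms of 1 + r + ... + r^n is at least r^n. *)
Lemma nexpr_bound r : 0 <= r < 1 -> forall n, n.+1%:R * r ^+ n <= (1 - r)^-1.
Proof.
move=> /andP[r0 r1] n.
have r1' : 0 < 1 - r by lra.
rewrite -[X in _ <= X]mul1r ler_pdivlMr //.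
have -> : n.+1%:R * r ^+ n = \sum_(i < n.+1) r ^+ n.
  by rewrite sumr_const card_ord -[RHS]mulr_natl.
apply: (@le_trans _ _ ((\sum_(i < n.+1) r ^+ i) * (1 - r))).
  rewrite ler_wpM2r ?(ltW r1') //; apply: ler_sum => i _.
  by rewrite ler_wiXn2l ?(ltW r1) // -ltnS.
have -> : (\sum_(i < n.+1) r ^+ i) * (1 - r) = 1 - r ^+ n.+1.
  rewrite mulrC; have := subrX1 r n.+1; move=> h.
  by rewrite -[1 - r]opprB mulNr -h opprB.
by rewrite gerBl exprn_ge0.
Qed.

(** The factor n+1 is absorbed by enlarging the radius from r to (1 + r)/2: it
    costs n+1 times the n-th power of a ratio smaller than one. *)
Lemma PS_le a b (C : R) : (forall n, cabs (b n) <= C * n.+1%:R * cabs (a n)) ->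
  PS a -> PS b.
Proof.
move=> hb ha r r01; have [s0 s1 rs q01] := midpoint_lt1 r01.
set s := (1 + r) / 2 in s0 s1 rs q01.
have [|M hM] := ha s; first by rewrite s1 ltW.
have [r0 _] := andP r01; have [q0 q1] := andP q01.
exists (`|C| * (1 - r / s)^-1 * M) => n.
have -> : r ^+ n = (r / s) ^+ n * s ^+ n.
  by rewrite -exprMn; congr (_ ^+ n); field; rewrite gt_eqF.
apply: (@le_trans _ _ (`|C| * n.+1%:R * cabs (a n) * ((r / s) ^+ n * s ^+ n))).
  rewrite ler_wpM2r ?mulr_ge0 ?exprn_ge0 ?(ltW s0) //.
  apply: le_trans (hb n) _; rewrite ler_wpM2r ?cabs_ge0 // ler_wpM2r //.
  exact: ler_norm.
have -> : `|C| * n.+1%:R * cabs (a n) * ((r / s) ^+ n * s ^+ n) =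
  `|C| * (n.+1%:R * (r / s) ^+ n) * (cabs (a n) * s ^+ n) by ring.
apply: ler_pM; rewrite ?mulr_ge0 ?exprn_ge0 ?cabs_ge0 ?(ltW s0) //.
by rewrite ler_wpM2l // nexpr_bound.
Qed.

Lemma PS_shift a : PS a -> PS (fun n => a n.+1).
Proof.
move=> ha r r01; have [s0 s1 rs q01] := midpoint_lt1 r01.
set s := (1 + r) / 2 in s0 s1 rs q01.
have [|M hM] := ha s; first by rewrite s1 ltW.
have [r0 _] := andP r01; exists (M / s) => n.
rewrite ler_pdivlMr //; apply: le_trans (hM n.+1).
rewrite exprSr mulrA ler_wpM2r ?(ltW s0) // ler_wpM2l ?cabs_ge0 //.
by rewrite lerXn2r // nnegrE ltW.
Qed.

Lemma PS_add a b : PS a -> PS b -> PS (fun n => a n + b n).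
Proof.
move=> ha hb r r01; have [M hM] := ha r r01; have [N hN] := hb r r01.
exists (M + N) => n; apply: le_trans (lerD (hM n) (hN n)).
rewrite -mulrDl ler_wpM2r ?cabsD // exprn_ge0 //; by case/andP: r01.
Qed.

Lemma PS_scale (k : Cplx R) a : PS a -> PS (fun n => k * a n).
Proof.
apply: (@PS_le _ _ (cabs k)) => n.
by rewrite cabsM ler_wpM2r ?cabs_ge0 // ler_peMr ?cabs_ge0 // ler1n.
Qed.

Lemma PS_bounded a (M : R) : (forall n, cabs (a n) <= M) -> PS a.
Proof.
move=> h r /andP[r0 r1]; exists M => n; apply: le_trans (h n).
by rewrite ler_piMr ?cabs_ge0 // exprn_ile1 // ltW.
Qed.

Lemma PS_natmul a : PS a -> PS (fun n => n.+1%:R * a n).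
Proof. by apply: (@PS_le _ _ 1) => n; rewrite cabsM cabs_nat mul1r. Qed.

Definition dps a n : Cplx R := n.+1%:R * a n.+1.

Lemma PS_d a : PS a -> PS (dps a).
Proof. by move=> /PS_shift; exact: PS_natmul. Qed.

Lemma ps_cvg a z : PS a -> cabs z < 1 ->
  series (fun k => a k * z ^+ k) @ \oo --> ps a z.
Proof.
move=> ha z1.
have z01 : 0 <= cabs z < 1 by rewrite cabs_ge0.
have hb n : cabs (a n * z ^+ n) <= cabs (a n) * cabs z ^+ n by rewrite cabsM cabsX.
have [l cl _] := cseries_dom hb (PS_sum ha z01).
by rewrite ps.unlock (cvgC_lim cl).
Qed.

Lemma ps_lim a z l : series (fun k => a k * z ^+ k) @ \oo --> l -> ps a z = l.
Proof. by rewrite ps.unlock; exact: cvgC_lim. Qed.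

Lemma ps_le a z (b : nat -> R) : (forall n, cabs (a n * z ^+ n) <= b n) -> cvgn (series b) ->
  cabs (ps a z) <= limn (series b).
Proof. by move=> h cb; have [l /ps_lim ->] := cseries_dom h cb. Qed.

Lemma ps_of_series a : (forall z : Cplx R, cabs z < 1 ->
  cvgn (series (fun k => a k * z ^+ k))) -> PS a.
Proof.
move=> h r /andP[r0 r1].
have /h/cvg_series_cvg_0/cvgCP h0 : cabs (ofR r) < 1 by rewrite cabs_ofR ger0_norm.
have [N _ hN] := h0 1 ltr01.
exists (1 + \sum_(i < N) (cabs (a i) * r ^+ i)) => n.
have p0 i : 0 <= cabs (a i) * r ^+ i by rewrite mulr_ge0 ?cabs_ge0 ?exprn_ge0.
have [Nn|nN] := leqP N n.
  apply: (@le_trans _ _ 1); last by rewrite lerDl sumr_ge0.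
  have := hN n Nn; rewrite /= sub0r cabsN cabsM cabsX cabs_ofR (ger0_norm r0).
  exact: ltW.
rewrite (bigD1 (Ordinal nN)) //=.
have : 0 <= \sum_(i < N | i != Ordinal nN) cabs (a i) * r ^+ i by rewrite sumr_ge0.
lra.
Qed.

Lemma eq_ps a b z : a =1 b -> ps a z = ps b z.
Proof. by move=> /funext ->. Qed.

Lemma ps_add a b z : PS a -> PS b -> cabs z < 1 ->
  ps (fun n => a n + b n) z = ps a z + ps b z.
Proof.
move=> ha hb z1; apply: ps_lim.
apply: eq_cvgn (cvgCD (ps_cvg ha z1) (ps_cvg hb z1)) => n.
rewrite /series /= -big_split /=.
by apply: eq_bigr => i _; rewrite mulrDl.
Qed.

Lemma ps_scale (k : Cplx R) a z : PS a -> cabs z < 1 ->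
  ps (fun n => k * a n) z = k * ps a z.
Proof.
move=> ha z1; apply: ps_lim.
apply: eq_cvgn (cvgCM (@cvgC_cst _ _ _ _ k) (ps_cvg ha z1)) => n.
rewrite /series /= mulr_sumr.
by apply: eq_bigr => i _; rewrite mulrA.
Qed.

Lemma ps_shift a z : PS a -> cabs z < 1 ->
  ps a z = a 0%N + z * ps (fun n => a n.+1) z.
Proof.
move=> ha z1; apply: ps_lim.
have h : (fun n => a 0%N + z * series (fun k => a k.+1 * z ^+ k) n) @ \oo -->
   a 0%N + z * ps (fun n => a n.+1) z.
  apply: cvgCD; first exact: cvgC_cst.
  by apply: cvgCM; [exact: cvgC_cst|apply: ps_cvg => //; exact: PS_shift].
rewrite -(cvg_shiftS (series (fun k => a k * z ^+ k))).
apply: eq_cvgn h => n.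
rewrite /series /= big_nat_recl // expr0 mulr1 mulr_sumr; congr (_ + _).
by apply: eq_bigr => i _; rewrite exprS mulrCA.
Qed.

Lemma ps0 a : ps a 0 = a 0%N.
Proof.
apply: ps_lim; rewrite -(cvg_shiftS (series (fun k => a k * 0 ^+ k))).
apply: eq_cvgn (@cvgC_cst _ _ _ _ _) => n.
rewrite /series /= big_nat_recl // expr0 mulr1 big1 ?addr0 // => i _.
by rewrite expr0n mulr0.
Qed.

(** Multiplying by 1 - z lowers the growth of polynomial coefficients; this
    evaluates the rational kernels below and gives the Abel summation bound. *)
Lemma ps_diff a z : PS a -> cabs z < 1 ->
  (1 - z) * ps a z = a 0%N + z * ps (fun n => a n.+1 - a n) z.
Proof.
move=> ha z1.
have -> : ps (fun n => a n.+1 - a n) z = ps (fun n => a n.+1) z - ps a z.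
  rewrite (@eq_ps _ (fun n => a n.+1 + (-1) * a n)); last by move=> n; rewrite mulN1r.
  rewrite ps_add // ?ps_scale ?mulN1r //; first exact: PS_shift.
  exact: PS_scale.
rewrite mulrBl mul1r mulrBr addrA; congr (_ - _); exact: ps_shift.
Qed.

(** The bound depends on z and h only through s and |h|^2, so that it can be
    summed against the coefficients of a series.  Induction on the exponent: the
    remainder of order n+1 is (h + z) times that of order n plus n z^(n-1) h^2. *)
Lemma expr_taylor_bound (z h : Cplx R) (s : R) n : cabs z <= s -> cabs (h + z) <= s ->
  cabs ((h + z) ^+ n.+2 - z ^+ n.+2 - n.+2%:R * z ^+ n.+1 * h) <=
    n.+2%:R ^+ 2 * s ^+ n * cabs h ^+ 2.
Proof.
move=> zs hs; have s0 : 0 <= s by apply: le_trans zs; exact: cabs_ge0.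
elim: n => [|n IH].
  have -> : (h + z) ^+ 2 - z ^+ 2 - 2%:R * z ^+ 1 * h = h ^+ 2 by ring.
  by rewrite cabsX expr0 mulr1 ler_peMl ?exprn_ge0 ?cabs_ge0 // exprn_ege1 // ler1n.
have -> : (h + z) ^+ n.+3 - z ^+ n.+3 - n.+3%:R * z ^+ n.+2 * h =
   (h + z) * ((h + z) ^+ n.+2 - z ^+ n.+2 - n.+2%:R * z ^+ n.+1 * h)
   + n.+2%:R * z ^+ n.+1 * h ^+ 2.
  by rewrite -[n.+3%:R]nat1r !exprS; ring.
apply: le_trans (cabsD _ _) _; rewrite !cabsM !cabsX cabs_nat.
apply: (@le_trans _ _ (s * (n.+2%:R ^+ 2 * s ^+ n * cabs h ^+ 2)
   + n.+2%:R * s ^+ n.+1 * cabs h ^+ 2)).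
  apply: lerD.
    by apply: ler_pM => //; exact: cabs_ge0.
  rewrite ler_wpM2r ?sqr_ge0 // ler_wpM2l //.
  by rewrite lerXn2r // nnegrE ?cabs_ge0.
have -> : s * (n.+2%:R ^+ 2 * s ^+ n * cabs h ^+ 2)
   + n.+2%:R * s ^+ n.+1 * cabs h ^+ 2 =
   (n.+2%:R ^+ 2 + n.+2%:R) * s ^+ n.+1 * cabs h ^+ 2 by rewrite [s ^+ n.+1]exprS; ring.
rewrite ler_wpM2r ?sqr_ge0 // ler_wpM2r ?exprn_ge0 //.
by rewrite -[n.+3%:R]natr1; have : (0 : R) <= n.+2%:R by []; nra.
Qed.

(** Summing the remainders of the monomials: this one estimate yields both the
    continuity of the sum and its termwise derivative. *)
Lemma ps_taylor_bound a (s : R) : PS a -> 0 <= s < 1 -> exists2 C, 0 <= C & forall z h,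
  cabs z <= s -> cabs (h + z) <= s ->
  cabs (ps a (h + z) - ps a z - ps (dps a) z * h) <= C * cabs h ^+ 2.
Proof.
move=> ha s01; have [s0 s1] := andP s01.
pose b n : Cplx R := n.+2%:R ^+ 2 * a n.+2.
have hb : PS b.
  have h2 : PS (fun n => a n.+2) by exact: (PS_shift (PS_shift ha)).
  apply: (@PS_le _ _ 4 _ (PS_natmul h2)) => n.
  rewrite (_ : 4 * n.+1%:R * _ = (2 * n.+1%:R) ^+ 2 * cabs (a n.+2)); last first.
    by rewrite cabsM cabs_nat; ring.
  rewrite /b cabsM cabsX cabs_nat ler_wpM2r ?cabs_ge0 //.
  by rewrite lerXn2r ?nnegrE // -natrM ler_nat; lia.
have cb := PS_sum hb s01.
exists (limn (series (fun n => cabs (b n) * s ^+ n))).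
  apply: limr_ge => //; apply: nearW => n; apply: sumr_ge0 => i _.
  by rewrite mulr_ge0 ?cabs_ge0 ?exprn_ge0.
move=> z h zs hs.
have z1 : cabs z < 1 by exact: le_lt_trans zs s1.
have h1 : cabs (h + z) < 1 by exact: le_lt_trans hs s1.
(* The n-th term of the remainder; its terms 0 and 1 vanish. *)
pose c n := a n * ((h + z) ^+ n - z ^+ n) - n%:R * a n * z ^+ n.-1 * h.
have cc : series c @ \oo --> ps a (h + z) - ps a z - ps (dps a) z * h.
  rewrite -(cvg_shiftS (series c)).
  have k1 := ps_cvg ha h1; have k2 := ps_cvg ha z1.
  have k3 := ps_cvg (PS_d ha) z1.
  rewrite -(cvg_shiftS (series _)) in k1.
  rewrite -(cvg_shiftS (series _)) in k2.
  apply: eq_cvgn (cvgCB (cvgCB k1 k2) (cvgCM k3 (@cvgC_cst _ _ _ _ h))) => n /=.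
  rewrite /series /= -sumrB !big_nat_recl // /c /= mulr_suml mul0r !mul0r subr0.
  rewrite mulrBr -[LHS]addrA -sumrB; congr (_ + _).
  by apply: eq_bigr => i _; rewrite /dps; ring.
have cc2 : series (fun n => c n.+2) @ \oo --> ps a (h + z) - ps a z - ps (dps a) z * h.
  rewrite -(cvg_shiftS (series c)) -(cvg_shiftS (fun n => series c n.+1)) in cc.
  have c0 : c 0%N = 0 by rewrite /c /=; ring.
  have c1 : c 1%N = 0 by rewrite /c /=; ring.
  by apply: eq_cvgn cc => n; rewrite /series /= !big_nat_recl // c0 c1 !add0r.
have hc n : cabs (c n.+2) <= cabs h ^+ 2 * (cabs (b n) * s ^+ n).
  have -> : c n.+2 = a n.+2 *
       ((h + z) ^+ n.+2 - z ^+ n.+2 - n.+2%:R * z ^+ n.+1 * h) by rewrite /c /=; ring.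
  rewrite cabsM /b cabsM cabsX cabs_nat.
  have -> : cabs h ^+ 2 * (n.+2%:R ^+ 2 * cabs (a n.+2) * s ^+ n) =
    cabs (a n.+2) * (n.+2%:R ^+ 2 * s ^+ n * cabs h ^+ 2) by ring.
  by rewrite ler_wpM2l ?cabs_ge0 // expr_taylor_bound.
have cb' : series (fun n => cabs h ^+ 2 * (cabs (b n) * s ^+ n)) @ \oo -->
    cabs h ^+ 2 * limn (series (fun n => cabs (b n) * s ^+ n)).
  apply: eq_cvgn (cvgM (cvg_cst (cabs h ^+ 2)) cb) => n.
  by rewrite /series /= mulr_sumr.
have [l cl hl] := cseries_dom hc (cvgP _ cb').
rewrite (cvg_lim (@Rhausdorff R) cb') mulrC in hl.
by rewrite -(cvgC_unique cl cc2).
Qed.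

End PowerSeries.

(** * Analytic functions and their coefficients *)

Section Analytic.
Variable R : realType.
Implicit Types (a b c : nat -> Cplx R) (f : Cplx R -> Cplx R) (z w : Cplx R).

Lemma ps_cvg_comp a z (T : Type) (F : set_system T) {FF : Filter F} (f : T -> Cplx R) :
  PS a -> cabs z < 1 -> f @ F --> z -> ps a (f x) @[x --> F] --> ps a z.
Proof.
move=> ha z1 /cvgCP hf; apply/cvgCP => e e0.
have [|s0 s1 rs _] := @midpoint_lt1 R (cabs z); first by rewrite cabs_ge0.
set s := (1 + cabs z) / 2 in s0 s1 rs.
have [|C C0 hC] := @ps_taylor_bound R a s ha; first by rewrite (ltW s0).
set D := cabs (ps (dps a) z).
have D0 : 0 <= D by exact: cabs_ge0.
pose d := Num.min 1 (Num.min (s - cabs z) (e / (C + D + 1))).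
have zs : cabs z < s by rewrite /s; lra.
have d0 : 0 < d by rewrite !lt_min ltr01 subr_gt0 zs divr_gt0 //; lra.
apply: filterS (hf d d0) => x; rewrite !lt_min => /and3P[h1 hs he].
have := hC z (f x - z) rs; rewrite subrK.
have -> : cabs (f x - z) = cabs (z - f x) by rewrite cabsB.
set t := cabs (z - f x) in h1 hs he *.
have t0 : 0 <= t by exact: cabs_ge0.
have fxs : cabs (f x) <= s.
  have -> : f x = z - (z - f x) by rewrite subKr.
  by apply: le_trans (cabsD _ _) _; rewrite cabsN -/t; lra.
move=> /(_ fxs) H.
have -> : ps a z - ps a (f x) =
  - (ps a (f x) - ps a z - ps (dps a) z * (f x - z)) + ps (dps a) z * (z - f x) by ring.
apply: le_lt_trans (cabsD _ _) _; rewrite cabsN cabsM -/D -/t.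
have he' : t * (C + D + 1) < e by move: he; rewrite ltr_pdivlMr //; lra.
have Ct : C * t ^+ 2 <= C * t.
  by rewrite ler_wpM2l // expr2 ler_piMl // ltW.
by apply: le_lt_trans he'; apply: (le_trans (lerD (le_trans H Ct) (lexx _))); lra.
Qed.

Lemma near0_cabs (d : R) : 0 < d ->
  \forall h \near (0 : Cplx R)^', h != 0 /\ cabs h < d.
Proof.
move=> d0.
have h0 : \forall h \near (0 : Cplx R)^', h != 0 by exact: nbhs_dnbhs_neq.
have h1 : \forall h \near (0 : Cplx R)^', cabs h < d.
  apply: (@cvg_within _ (nbhs (0 : Cplx R))).
  have /cvgCP/(_ d d0) : (id : Cplx R -> Cplx R) @ nbhs (0 : Cplx R) --> (0 : Cplx R) by [].
  by apply: filterS => x; rewrite /= sub0r cabsN.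
by apply: filterS2 h0 h1.
Qed.

Definition is_ps f a := PS a /\ forall z, cabs z < 1 -> f z = ps a z.

(** Only the values of [f] on the disk matter, since the derivative at a point
    of the open disk is local. *)
Lemma is_ps_derive1 f a : is_ps f a -> is_ps (derive1 f) (dps a).
Proof.
move=> [ha fa]; split=> [|z z1]; first exact: PS_d.
apply: cvgC_lim; apply/cvgCP => e e0.
have [|s0 s1 rs _] := @midpoint_lt1 R (cabs z); first by rewrite cabs_ge0.
set s := (1 + cabs z) / 2 in s0 s1 rs.
have [|C C0 hC] := @ps_taylor_bound R a s ha; first by rewrite (ltW s0).
pose d := Num.min (s - cabs z) (e / (C + 1)).
have zs : cabs z < s by rewrite /s; lra.
have d0 : 0 < d by rewrite !lt_min subr_gt0 zs divr_gt0 //; lra.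
apply: filterS (near0_cabs d0) => h [h0]; rewrite lt_min => /andP[hs he].
have hzs : cabs (h + z) <= s by apply: le_trans (cabsD _ _) _; lra.
rewrite [X in cabs (_ - X)](_ : _ = h^-1 * (f (h + z) - f z)) //.
have := hC z h rs hzs.
rewrite (fa z z1) (fa (h + z) (le_lt_trans hzs s1)).
have t0 : 0 < cabs h by rewrite cabs_gt0.
have -> : ps (dps a) z - h^-1 * (ps a (h + z) - ps a z) =
  - h^-1 * (ps a (h + z) - ps a z - ps (dps a) z * h).
  by rewrite mulNr [in RHS]mulrBr opprB [h^-1 * (ps (dps a) z * h)]mulrCA mulVf // mulr1.
rewrite cabsM cabsN cabsV => H.
apply: (@le_lt_trans _ _ (C * cabs h)).
  rewrite mulrC ler_pdivrMr // -mulrA -expr2 //.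
rewrite ltr_pdivlMr in he; last lra.
nra.
Qed.

Lemma is_ps_derive1n n f a : is_ps f a ->
  is_ps (derive1n n f) (fun k => ((k + n) ^_ n)%:R * a (k + n)%N).
Proof.
move=> fa; elim: n => [|n IH].
  have -> // : (fun k => ((k + 0) ^_ 0)%:R * a (k + 0)%N) = a.
  by apply/funext => k; rewrite ffactn0 addn0 mul1r.
have -> : (fun k => ((k + n.+1) ^_ n.+1)%:R * a (k + n.+1)%N) =
    dps (fun k => ((k + n) ^_ n)%:R * a (k + n)%N).
  apply/funext => k; rewrite /dps mulrA -natrM; congr (_%:R * a _); last lia.
  by rewrite -addSnnS ffactnSr addnK mulnC.
exact: is_ps_derive1.
Qed.

(** This identifies the coefficients on which the Hadamard product acts with
    those of any power series representing the function. *)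
Lemma taylor_coef_ps f a : is_ps f a -> taylor_coef f = a.
Proof.
move=> fa; apply/funext => n; have [_ h] := is_ps_derive1n n fa.
rewrite /taylor_coef h ?cabs0 // ps0 add0n ffactnn mulrC mulKf //.
Qed.

(** The terms of a convergent series are bounded, which turns convergence at the
    point r into the bound defining [PS]. *)
Lemma analytic_ps f : analytic_in_disk f <-> exists a, is_ps f a.
Proof.
split=> [[a ha]|[a [ha fa]]].
  exists a; split=> [|z z1]; last by rewrite (ps_lim (ha z _)) // ltR_norm1.
  by apply: ps_of_series => z z1; apply: (cvgP (f z)); apply: ha; rewrite ltR_norm1.
by exists a => z; rewrite ltR_norm1 => z1; rewrite fa //; exact: ps_cvg.
Qed.

Lemma is_ps_id a : PS a -> is_ps (ps a) a. Proof. by []. Qed.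

Lemma eq_is_ps f g a b : (forall z, cabs z < 1 -> f z = g z) -> a =1 b ->
  is_ps f a -> is_ps g b.
Proof. by move=> fg /funext <- [ha fa]; split=> // z z1; rewrite -fg // fa. Qed.

Definition zps a n : Cplx R := if n is m.+1 then a m else 0.

Lemma is_ps_mulz f a : is_ps f a -> is_ps (fun z => z * f z) (zps a).
Proof.
move=> [ha fa].
have hz : PS (zps a).
  move=> r r01; have [M hM] := ha r r01; have [r0 r1] := andP r01.
  have M0 : 0 <= M by apply: le_trans (hM 0%N); rewrite expr0 mulr1 cabs_ge0.
  exists M => -[|n] /=; first by rewrite cabs0 mul0r.
  rewrite exprSr mulrA; apply: le_trans (hM n).
  by rewrite ler_piMr ?(ltW r1) // mulr_ge0 ?cabs_ge0 ?exprn_ge0.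
by split=> // z z1; rewrite ps_shift // add0r fa.
Qed.

Lemma is_ps_divz f a : is_ps f a -> a 0%N = 0 ->
  forall z, cabs z < 1 -> f z = z * ps (fun n => a n.+1) z.
Proof. by move=> [ha fa] a0 z z1; rewrite fa // ps_shift // a0 add0r. Qed.

Lemma overz_ps f a z : is_ps f a -> a 0%N = 0 -> cabs z < 1 ->
  overz f z = ps (fun n => a n.+1) z.
Proof.
move=> fa a0 z1; rewrite /overz; case: eqP => [->|/eqP z0].
  have [_ ->] := is_ps_derive1 fa; last by rewrite cabs0.
  by rewrite !ps0 /dps mul1r.
by rewrite (is_ps_divz fa a0 z1) mulrAC divff // mul1r.
Qed.

Lemma is_ps0 f a : is_ps f a -> f 0 = a 0%N.
Proof. by move=> [_ ->]; rewrite ?ps0 ?cabs0. Qed.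

Lemma classA_ps f : classA f <-> exists a, [/\ is_ps f a, a 0%N = 0 & a 1%N = 1].
Proof.
split=> [[/analytic_ps[a fa] f0 f1]|[a [fa a0 a1]]].
  exists a; split=> //; first by rewrite -(is_ps0 fa).
  by rewrite -f1 (is_ps0 (is_ps_derive1 fa)) /dps mul1r.
split; first by apply/analytic_ps; exists a.
  by rewrite (is_ps0 fa).
by rewrite (is_ps0 (is_ps_derive1 fa)) /dps mul1r.
Qed.

End Analytic.

(** * Averages over roots of unity *)

HB.lock Definition unit_root (R : realType) (M : nat) : Cplx R := expi (2 * pi / M%:R).
HB.lock Definition unit_root' (R : realType) (M : nat) : Cplx R :=
  expi (- (2 * pi / M%:R)).

Section ConvolutionPositivity.
Variable R : realType.
Implicit Types (a q : nat -> Cplx R) (z w u : Cplx R) (n m N M : nat).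

Definition trunc a N u : Cplx R := \sum_(n < N) a n * u ^+ n.

(** Uniformity on closed disks allows the circle to be replaced by finitely many
    of its points in [convolution_Re_ge0]. *)
Lemma ps_trunc a (r e : R) : PS a -> 0 <= r < 1 -> 0 < e ->
  exists N0, forall N u, (N0 <= N)%N -> cabs u <= r -> cabs (ps a u - trunc a N u) <= e.
Proof.
move=> ha r01 e0; have [r0 r1] := andP r01.
have cT := PS_sum ha r01.
set T := series _ in cT.
have Tnd : nondecreasing_seq T.
  apply: nondecreasing_series => n _ _.
  by rewrite mulr_ge0 ?cabs_ge0 ?exprn_ge0.
have /cvgrPdist_le/(_ e e0)[N0 _ hN0] := cT.
exists N0 => N u hN ur.
apply: (@le_trans _ _ (limn T - T N)); last first.
  by apply: le_trans (hN0 N hN); rewrite ler_norm.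
apply/ler_addgt0Pr => d d0.
have u1 : cabs u < 1 by exact: le_lt_trans ur r1.
have /cvgCP/(_ d d0)[K _ hK] := ps_cvg ha u1.
pose L := maxn K N.
have := hK L (leq_maxl _ _) => /ltW hL.
have -> : ps a u - trunc a N u = (series (fun k => a k * u ^+ k) L - trunc a N u)
   + (ps a u - series (fun k => a k * u ^+ k) L) by ring.
apply: le_trans (cabsD _ _) _; apply: lerD => //.
have -> : trunc a N u = series (fun k => a k * u ^+ k) N.
  by rewrite /series /= big_mkord.
have NL : (N <= L)%N := leq_maxr _ _.
rewrite sub_series_geq //.
apply: (@le_trans _ _ (T L - T N)); last by rewrite lerD2r; exact: nondecreasing_cvgn_le.
rewrite sub_series_geq //; apply: le_trans (cabs_sum _ _) _.
apply: ler_sum => i _; rewrite cabsM cabsX ler_wpM2l ?cabs_ge0 //.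
by rewrite lerXn2r ?nnegrE ?cabs_ge0.
Qed.

Lemma expiD (x y : R) : expi (x + y) = expi x * expi y.
Proof. by apply: eq_Cplx; rewrite /= ?cosD ?sinD; ring. Qed.

Lemma expi0 : expi 0 = 1 :> Cplx R.
Proof. by apply: eq_Cplx; rewrite /= ?cos0 ?sin0. Qed.

Lemma expiX (x : R) n : expi x ^+ n = expi (n%:R * x).
Proof.
elim: n => [|n IH]; first by rewrite mul0r expi0.
by rewrite exprS IH -expiD -nat1r mulrDl mul1r.
Qed.

Lemma cabs_expi (x : R) : cabs (expi x) = 1.
Proof. by rewrite cabs.unlock /= cos2Dsin2 sqrtr1. Qed.

(** By cos x = 1 - 2 sin^2 (x/2), and the sine is positive on ]0, pi[. *)
Lemma expi_neq1 (x : R) : 0 < x < 2 * pi -> expi x != 1.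
Proof.
move=> /andP[x0 x1]; apply/eqP => /(congr1 (@complex.Re R)) /= cx.
have s0 : 0 < sin (x / 2) by apply: sin_gt0_pi; rewrite divr_gt0 //= ltr_pdivrMr // mulrC.
have : cos x = 1 - sin (x / 2) ^+ 2 *+ 2.
  have {1}-> : x = x / 2 + x / 2 by rewrite -splitr.
  have := cos2Dsin2 (x / 2); rewrite cosD => h.
  by move: h; rewrite mulr2n !expr2; lra.
rewrite cx; have := exprn_gt0 2 s0; lra.
Qed.

Variable M : nat.
Hypothesis M0 : (0 < M)%N.

Local Notation unit_root := (@unit_root R M).
Local Notation unit_root' := (@unit_root' R M).

Lemma unit_rootK : unit_root * unit_root' = 1.
Proof. by rewrite unit_root.unlock unit_root'.unlock -expiD subrr expi0. Qed.

Lemma unit_rootX : unit_root ^+ M = 1.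
Proof.
rewrite unit_root.unlock expiX mulrCA divff ?mulr1; last by rewrite pnatr_eq0 -lt0n.
by apply: eq_Cplx; rewrite /= ?mulr_natl ?cos2pi ?sin2pi.
Qed.

Lemma unit_rootX' : unit_root' ^+ M = 1.
Proof. by rewrite -[LHS]mul1r -{1}unit_rootX -exprMn unit_rootK expr1n. Qed.

Lemma unit_root_neq1 n : (0 < n < M)%N -> unit_root ^+ n != 1.
Proof.
move=> /andP[n0 nM]; rewrite unit_root.unlock expiX expi_neq1 //.
have M0' : (0 : R) < M%:R by rewrite ltr0n.
have n0' : (0 : R) < n%:R by rewrite ltr0n.
have nM' : (n%:R : R) < M%:R by rewrite ltr_nat.
have pi0 := pi_gt0 R.
rewrite mulr_gt0 ?divr_gt0 ?mulr_gt0 //= mulrCA -[X in _ < X]mulr1.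
by rewrite ltr_pM2l ?mulr_gt0 // ltr_pdivrMr // mul1r.
Qed.

Lemma unit_root_neq1' n : (0 < n < M)%N -> unit_root' ^+ n != 1.
Proof.
move=> /unit_root_neq1; apply: contra => /eqP h.
by rewrite -[unit_root ^+ n]mulr1 -{1}h -exprMn unit_rootK expr1n.
Qed.

Lemma sum_root (x : Cplx R) : x ^+ M = 1 -> x != 1 -> \sum_(j < M) x ^+ j = 0.
Proof.
move=> xM x1; have := subrX1 x M; rewrite xM subrr => /esym/eqP.
by rewrite mulf_eq0 subr_eq0 (negPf x1) /= => /eqP.
Qed.

Lemma sum_root_ortho n m : (n < M)%N -> (m < M)%N ->
  \sum_(j < M) (unit_root ^+ n * unit_root' ^+ m) ^+ j = if n == m then M%:R else 0.
Proof.
move=> nM mM; case: (ltngtP n m) => [nm|mn|->].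
- have -> : unit_root ^+ n * unit_root' ^+ m = unit_root' ^+ (m - n).
    by rewrite -{1}(subnKC (ltnW nm)) exprD mulrA -exprMn unit_rootK expr1n mul1r.
  apply: sum_root; first by rewrite -exprM mulnC exprM unit_rootX' expr1n.
  by apply: unit_root_neq1'; lia.
- have -> : unit_root ^+ n * unit_root' ^+ m = unit_root ^+ (n - m).
    by rewrite -{1}(subnK (ltnW mn)) exprD -mulrA -exprMn unit_rootK expr1n mulr1.
  apply: sum_root; first by rewrite -exprM mulnC exprM unit_rootX expr1n.
  by apply: unit_root_neq1; lia.
- rewrite -exprMn unit_rootK expr1n; under eq_bigr do rewrite expr1n.
  by rewrite sumr_const card_ord.
Qed.

Lemma sum_root_ortho' n m : (n + m < M)%N ->
  \sum_(j < M) (unit_root' ^+ n * unit_root' ^+ m) ^+ j = if (n + m == 0)%N then M%:R else 0.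
Proof.
move=> nmM; rewrite -exprD; case: eqP => [->|/eqP nm0].
  by under eq_bigr do rewrite expr0 expr1n; rewrite sumr_const card_ord.
apply: sum_root; first by rewrite -exprM mulnC exprM unit_rootX' expr1n.
by apply: unit_root_neq1'; lia.
Qed.

Definition Cconj z : Cplx R := Complex (complex.Re z) (- complex.Im z).

Lemma Cconj_rmorph : exists h : {rmorphism Cplx R -> Cplx R}, h =1 Cconj.
Proof. by exists (conjc : {rmorphism R[i] -> R[i]}); case. Qed.

Lemma CconjM z w : Cconj (z * w) = Cconj z * Cconj w.
Proof. by have [h hE] := Cconj_rmorph; rewrite -!hE rmorphM. Qed.
Lemma CconjX z n : Cconj (z ^+ n) = Cconj z ^+ n.
Proof. by have [h hE] := Cconj_rmorph; rewrite -!hE rmorphXn. Qed.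
Lemma Cconj_sum (I : Type) (s : seq I) (F : I -> Cplx R) :
  Cconj (\sum_(i <- s) F i) = \sum_(i <- s) Cconj (F i).
Proof.
have [h hE] := Cconj_rmorph; rewrite -hE rmorph_sum.
by apply: eq_bigr => i _; rewrite hE.
Qed.
Lemma addCconj z : z + Cconj z = ofR (2 * complex.Re z).
Proof. by apply: eq_Cplx; rewrite ?ReD ?ImD /=; ring. Qed.
Lemma Cconj_unit_root : Cconj unit_root = unit_root'.
Proof. by rewrite unit_root.unlock unit_root'.unlock; apply: eq_Cplx; rewrite /= ?cosN ?sinN. Qed.
Lemma cabs_unit_root n : cabs (unit_root ^+ n) = 1.
Proof. by rewrite cabsX unit_root.unlock cabs_expi expr1n. Qed.
Lemma cabs_unit_root' n : cabs (unit_root' ^+ n) = 1.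
Proof. by rewrite cabsX unit_root'.unlock cabs_expi expr1n. Qed.
Lemma Cconj_ofR (x : R) : Cconj (ofR x) = ofR x.
Proof. by apply: eq_Cplx; rewrite /= ?oppr0. Qed.

End ConvolutionPositivity.

(** * Convolution and positive real part *)

Section ConvolutionPositivity2.
Variable R : realType.
Implicit Types (a q : nat -> Cplx R) (z w u x y : Cplx R) (n m N : nat).

Let mulr_regroup (A B C D E F : Cplx R) : A * (B * C) * (D * (E * F)) = C * F * (A * D * (B * E)).
Proof. by ring. Qed.

Section Averages.
Variables (N : nat) (a q : nat -> Cplx R) (x y : Cplx R).
Hypothesis N0 : (0 < N)%N.
Let M := (2 * N)%N.
Let M0 : (0 < M)%N. Proof. by rewrite muln_gt0. Qed.
Let o := @unit_root R M.
Let o' := @unit_root' R M.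

(** Orthogonality of the characters of Z/M.  As M = 2N exceeds every sum of two
    exponents, the average of the truncations is exact: nothing is aliased. *)
Lemma avg_conv : \sum_(j < M) trunc a N (x * o ^+ j) * trunc q N (y * o' ^+ j) =
  M%:R * trunc (fun n => a n * q n) N (x * y).
Proof.
under eq_bigr do rewrite big_distrlr /=.
rewrite exchange_big mulr_sumr; apply: eq_bigr => n _.
rewrite exchange_big (bigD1 n) //= [X in _ + X]big1 ?addr0 => [|m mn].
  have -> : M%:R * (a n * q n * (x * y) ^+ n) = \sum_(j < M) (o ^+ n * o' ^+ n) ^+ j *
     (a n * q n * (x * y) ^+ n).
    by rewrite -mulr_suml (@sum_root_ortho R M M0) ?eqxx //; have := ltn_ord n; rewrite /M; lia.
  apply: eq_bigr => j _; rewrite [(x * o ^+ j) ^+ n]exprMn [(y * o' ^+ j) ^+ n]exprMn.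
  by rewrite mulr_regroup [(x * y) ^+ n]exprMn [in RHS]exprMn -!exprM [(j * n)%N]mulnC.
transitivity (\sum_(j < M) (o ^+ n * o' ^+ m) ^+ j * (a n * q m * (x ^+ n * y ^+ m))).
  apply: eq_bigr => j _; rewrite [(x * o ^+ j) ^+ n]exprMn [(y * o' ^+ j) ^+ m]exprMn.
  by rewrite mulr_regroup [in RHS]exprMn -!exprM ![(j * _)%N]mulnC.
rewrite -mulr_suml (@sum_root_ortho R M M0); last 2 first.
- by have := ltn_ord n; rewrite /M; lia.
- by have := ltn_ord m; rewrite /M; lia.
by move: mn; rewrite -val_eqE eq_sym => /negPf /= ->; rewrite mul0r.
Qed.

(** For the conjugate factor the exponents add up instead of cancelling, and
    n + m = 0 mod M only for n = m = 0, again because M = 2N. *)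
Lemma avg_conj : \sum_(j < M) Cconj (trunc a N (x * o ^+ j)) * trunc q N (y * o' ^+ j) =
  M%:R * (Cconj (a 0%N) * q 0%N).
Proof.
under eq_bigr do rewrite Cconj_sum big_distrlr /=.
have h (n m : nat) : (n < N)%N -> (m < N)%N ->
  \sum_(j < M) Cconj (a n * (x * o ^+ j) ^+ n) * (q m * (y * o' ^+ j) ^+ m) =
  (if (n + m == 0)%N then M%:R else 0) * (Cconj (a n * x ^+ n) * (q m * y ^+ m)).
  move=> nN mN; rewrite -(@sum_root_ortho' R M M0); last by rewrite /M; lia.
  rewrite mulr_suml; apply: eq_bigr => j _.
  rewrite !CconjM !CconjX !CconjM !CconjX Cconj_unit_root.
  rewrite [(Cconj x * _) ^+ n]exprMn [(y * _) ^+ m]exprMn mulr_regroup [in RHS]exprMn -!exprM.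
  by rewrite ![(j * _)%N]mulnC -!mulrA [q m * _]mulrCA.
rewrite exchange_big (bigD1 (Ordinal N0)) //= [X in _ + X]big1 ?addr0 => [|n n0]; last first.
  rewrite exchange_big big1 //= => m _; rewrite h //.
  have : (n : nat) != 0%N by rewrite -val_eqE in n0.
  by case: (n : nat) => //= k _; rewrite mul0r.
rewrite exchange_big (bigD1 (Ordinal N0)) //= [X in _ + X]big1 ?addr0 => [|n n0]; last first.
  rewrite h //.
  have : (n : nat) != 0%N by rewrite -val_eqE in n0.
  by case: (n : nat) => //= k _; rewrite mul0r.
by rewrite h //= !expr0 !mulr1.
Qed.

End Averages.

Definition delta0 n : Cplx R := if n == 0%N then 1 else 0.

Lemma trunc_delta0 N u : (0 < N)%N -> trunc delta0 N u = 1.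
Proof.
case: N => // N _; rewrite /trunc big_ord_recl big1 ?addr0; first by rewrite mul1r expr0.
by move=> i _; rewrite mul0r.
Qed.

Lemma trunc_deltaM a N u : (0 < N)%N -> trunc (fun n => delta0 n * a n) N u = a 0%N.
Proof.
case: N => // N _; rewrite /trunc big_ord_recl big1 ?addr0; first by rewrite mul1r mulr1.
by move=> i _; rewrite !mul0r.
Qed.

Lemma PS_delta0 : PS delta0.
Proof. by apply: (@PS_bounded _ _ 1) => -[|n]; rewrite /delta0 /= ?cabs1 // cabs0. Qed.

Lemma ps_delta0 u : ps delta0 u = 1.
Proof.
apply: ps_lim; rewrite -(cvg_shiftS (series _)).
apply: eq_cvgn (@cvgC_cst _ _ _ _ 1) => n.
by rewrite /series /= big_nat_recl // mul1r expr0 big1 ?addr0 // => i _; rewrite mul0r.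
Qed.

Lemma ps_deltaM a u : ps (fun n => delta0 n * a n) u = a 0%N.
Proof.
apply: ps_lim; rewrite -(cvg_shiftS (series _)).
apply: eq_cvgn (@cvgC_cst _ _ _ _ (a 0%N)) => n.
rewrite /series /= big_nat_recl // mul1r expr0 mulr1 big1 ?addr0 // => i _.
by rewrite !mul0r.
Qed.

Lemma avg_right q N y : (0 < N)%N ->
  \sum_(j < 2 * N) trunc q N (y * unit_root' R (2 * N) ^+ j) = (2 * N)%:R * q 0%N.
Proof.
move=> N0; have := @avg_conv N delta0 q 1 y N0.
rewrite trunc_deltaM // => <-; apply: eq_bigr => j _.
by rewrite trunc_delta0 // mul1r.
Qed.

Lemma avg_left a N x : (0 < N)%N ->
  \sum_(j < 2 * N) trunc a N (x * unit_root R (2 * N) ^+ j) = (2 * N)%:R * a 0%N.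
Proof.
move=> N0; have := @avg_conv N a delta0 x 1 N0.
have -> : trunc (fun n => a n * delta0 n) N (x * 1) = a 0%N.
  rewrite -(@trunc_deltaM a N (x * 1)) //.
  by apply: eq_bigr => i _; rewrite [a i * _]mulrC.
by move=> <-; apply: eq_bigr => j _; rewrite trunc_delta0 // mulr1.
Qed.

(** Split r as the product of its square root with itself. *)
Lemma PS_hadamard a q : PS a -> PS q -> PS (fun n => a n * q n).
Proof.
move=> ha hq r /andP[r0 r1].
have s01 : 0 <= Num.sqrt r < 1.
  by rewrite sqrtr_ge0 /= -[X in _ < X]sqrtr1 ltr_sqrt.
have [K hK] := ha _ s01; have [L hL] := hq _ s01.
exists (K * L) => n; have s0 := sqrtr_ge0 r.
have -> : r ^+ n = Num.sqrt r ^+ n * Num.sqrt r ^+ n by rewrite -exprMn -expr2 sqr_sqrtr.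
rewrite cabsM mulrACA; apply: ler_pM => //; by rewrite mulr_ge0 ?cabs_ge0 ?exprn_ge0.
Qed.

Lemma common_upper_bound (N1 N2 N3 : nat) :
  exists N, [/\ (0 < N)%N, (N1 <= N)%N, (N2 <= N)%N & (N3 <= N)%N].
Proof. by exists (N1 + N2 + N3).+1; split; lia. Qed.

(** The function A * Q + A(0) Q(0) is the average over |w| = 1 of
    2 Re A(s w) Q(y / w) at the point z = s y: writing 2 Re A as A plus its
    conjugate, the first summand gives the Hadamard product and the second one
    A(0) Q(0), as A(0) is real.  An average of numbers of nonnegative real part
    has nonnegative real part.  The circle is replaced by roots of unity and the
    series by truncations, for which the identity is exact; the error e is the
    distance of the truncations to the series. *)
Lemma convolution_Re_ge0 a q (b : R) z : PS a -> PS q -> a 0%N = ofR b ->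
  (forall u, cabs u < 1 -> 0 <= complex.Re (ps a u)) ->
  (forall u, cabs u < 1 -> 0 <= complex.Re (ps q u)) ->
  cabs z < 1 -> 0 <= complex.Re (ps (fun n => a n * q n) z + ofR b * q 0%N).
Proof.
move=> ha hq a0 pa pq z1; rewrite ReD ReZ.
set X := complex.Re _; set q0 := complex.Re _.
have b0 : 0 <= b by have := pa 0; rewrite cabs0 ps0 a0 /= => ->.
have q00 : 0 <= q0 by have := pq 0; rewrite cabs0 ps0 => ->.
have [|s0 s1 rs z01] := @midpoint_lt1 R (cabs z); first by rewrite cabs_ge0.
set s := (1 + cabs z) / 2 in s0 s1 rs z01.
pose y := z / ofR s.
have yE : cabs y = cabs z / s by rewrite /y cabsM cabsV cabs_ofR gtr0_norm.
have zE : z = ofR s * y.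
  by rewrite /y mulrC divfK // -cabs_eq0 cabs_ofR normr_eq0 gt_eqF.
have main (e : R) : 0 < e -> - (2 * e * (b + q0 + e) + e) <= X + b * q0.
  move=> e0.
  have [N1 h1] := @ps_trunc R a s e ha (introT andP (conj (ltW s0) s1)) e0.
  have [N2 h2] := @ps_trunc R q _ e hq z01 e0.
  have [|N3 h3] := @ps_trunc R _ (cabs z) e (PS_hadamard ha hq) _ e0.
    by rewrite cabs_ge0.
  have [N [N0 nN1 nN2 nN3]] := common_upper_bound N1 N2 N3.
  pose M := (2 * N)%N.
  pose A j := complex.Re (trunc a N (ofR s * unit_root R M ^+ j)).
  pose Q j := complex.Re (trunc q N (y * unit_root' R M ^+ j)).
  have cr j : cabs (ofR s * unit_root R M ^+ j) = s.
    by rewrite cabsM cabs_unit_root mulr1 cabs_ofR gtr0_norm.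
  have cr' j : cabs (y * unit_root' R M ^+ j) = cabs z / s.
    by rewrite cabsM cabs_unit_root' mulr1 yE.
  have A0 j : 0 <= A j + e.
    have k1 : cabs (ofR s * unit_root R M ^+ j) < 1 by rewrite cr.
    have k2 := h1 N (ofR s * unit_root R M ^+ j) nN1; rewrite cr in k2.
    have := le_trans (le_Re_cabs _) (k2 (lexx _)); rewrite ReB ler_norml => /andP[_ k4].
    have := pa _ k1; rewrite /A; lra.
  have Q0 j : 0 <= Q j + e.
    have k1 : cabs (y * unit_root' R M ^+ j) < 1 by rewrite cr'; case/andP: z01.
    have k2 := h2 N (y * unit_root' R M ^+ j) nN2; rewrite cr' in k2.
    have := le_trans (le_Re_cabs _) (k2 (lexx _)); rewrite ReB ler_norml => /andP[_ k4].
    have := pq _ k1; rewrite /Q; lra.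
  have sA : \sum_(j < M) A j = M%:R * b.
    by rewrite -Re_sum avg_left // a0 -ofR_nat -ofRM.
  have sQ : \sum_(j < M) Q j = M%:R * q0.
    by rewrite -Re_sum avg_right // -ofR_nat ReZ.
  pose XN := complex.Re (trunc (fun n => a n * q n) N z).
  have sAQ : \sum_(j < M) (2 * A j) * Q j = M%:R * (XN + b * q0).
    have := avg_conv a q (ofR s) y N0; have := avg_conj a q (ofR s) y N0.
    rewrite -/M -zE a0 Cconj_ofR => E1 E2.
    rewrite /XN.
    have -> : b * q0 = complex.Re (ofR b * q 0%N) by rewrite ReZ.
    rewrite -ReD -ReZ ofR_nat mulrDr -E1 -E2 -big_split Re_sum.
    by apply: eq_bigr => j _; rewrite /= -mulrDl addCconj ReZ.
  have M0 : (0 : R) < M%:R by rewrite ltr0n muln_gt0.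
  have : 0 <= \sum_(j < M) (A j + e) * (Q j + e).
    by apply: sumr_ge0 => j _; exact: mulr_ge0 (A0 _) (Q0 _).
  have -> : \sum_(j < M) (A j + e) * (Q j + e) =
      \sum_(j < M) (2 * A j * Q j / 2 + e * A j + e * Q j + e ^+ 2).
    by apply: eq_bigr => j _; field.
  rewrite !big_split /= -mulr_suml -!mulr_sumr sAQ sA sQ sumr_const card_ord.
  rewrite -[e *+ _]mulr_natl.
  have -> : M%:R * (XN + b * q0) / 2 + e * (M%:R * b) + e * (M%:R * q0) + e * (M%:R * e)
    = M%:R * ((XN + b * q0 + 2 * e * (b + q0 + e)) / 2) by field.
  rewrite pmulr_rge0 // => k1.
  have := le_trans (le_Re_cabs _) (h3 N z nN3 (lexx _)).
  rewrite ReB ler_norml -/X -/XN => /andP[k4 _]; lra.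
(* A negative value would contradict the bound for a small enough e. *)
rewrite leNgt; apply/negP => neg.
pose c := b + q0; have c0 : 0 <= c by rewrite addr_ge0.
pose e := Num.min 1 (- (X + b * q0) / (2 * (2 * c + 3))).
have e0 : 0 < e by rewrite lt_min ltr01 divr_gt0 //; lra.
have e1 : e <= 1 by rewrite ge_min lexx.
have e2 : e * (2 * (2 * c + 3)) <= - (X + b * q0).
  by rewrite -ler_pdivlMr; [rewrite ge_min lexx orbT|lra].
have := main e e0; rewrite -/c.
nra.
Qed.

(** The minimum principle needed here is Harnack's inequality, itself a case of
    [convolution_Re_ge0]: the real part of 1/(1 - s z) is at least 1/(1 + s) on
    the disk, and convolution with 1/(1 - s z) - 1/(1 + s) gives
    Re Q(s y) >= (1 - s)/(1 + s) Re Q(0). *)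
Lemma harnack q z : PS q -> (forall u, cabs u < 1 -> 0 <= complex.Re (ps q u)) ->
  cabs z < 1 -> 0 < complex.Re (q 0%N) -> 0 < complex.Re (ps q z).
Proof.
move=> hq pq z1 q00.
have [|s0 s1 rs z01] := @midpoint_lt1 R (cabs z); first by rewrite cabs_ge0.
set s := (1 + cabs z) / 2 in s0 s1 rs z01.
pose y := z / ofR s.
have y1 : cabs y < 1.
  by rewrite /y cabsM cabsV cabs_ofR gtr0_norm //; case/andP: z01.
have zE : z = ofR s * y.
  by rewrite /y mulrC divfK // -cabs_eq0 cabs_ofR normr_eq0 gt_eqF.
pose g n : Cplx R := ofR s ^+ n.
have gb n : cabs (g n) <= 1.
  by rewrite cabsX cabs_ofR gtr0_norm // exprn_ile1 // ltW.
have hg : PS g by apply: PS_bounded gb.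
pose k : R := (1 + s)^-1.
pose a n := g n + ofR (- k) * delta0 n.
have hd := PS_delta0.
have ha : PS a by apply: PS_add => //; exact: PS_scale.
have k0 : 0 < k by rewrite invr_gt0; lra.
have ks : k * (1 + s) = 1 by rewrite mulVf // gt_eqF //; lra.
have psg u : cabs u < 1 -> (1 - ofR s * u) * ps g u = 1.
  move=> u1; have E : ps g u = 1 + ofR s * u * ps g u.
    rewrite {1}ps_shift // (_ : g 0%N = 1) // -mulrA; congr (_ + _).
    rewrite [RHS]mulrCA; congr (_ * _); rewrite -ps_scale //.
    by apply: eq_ps => n; rewrite /g exprS.
  by rewrite mulrBl mul1r {1}E addrK.
have pa u : cabs u < 1 -> 0 <= complex.Re (ps a u).
  move=> u1; rewrite ps_add //; last exact: PS_scale.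
  rewrite ps_scale // ps_delta0 mulr1 ReD /=.
  have E1 := congr1 (@complex.Re R) (psg u u1).
  have E2 := congr1 (@complex.Im R) (psg u u1).
  move: E1 E2; rewrite ReM ImM ReB ImB ReZ ImZ /=.
  set c := complex.Re (ps g u); set d := complex.Im (ps g u).
  have xy : complex.Re u ^+ 2 + complex.Im u ^+ 2 <= 1.
    move: (u1); rewrite cabs.unlock; case: (u) => v w /= /ltW h.
    rewrite -[X in _ <= X]sqrtr1 in h; move: h.
    by rewrite ler_psqrt // nnegrE ?addr_ge0 ?sqr_ge0.
  move: (complex.Re u) (complex.Im u) xy => v w xy E1 E2.
  rewrite -/c -/d in E1 E2 *; move: c d E1 E2 => c d E1 E2.
  pose p := 1 - s * v; pose m := - (s * w).
  have F1 : p * c - m * d = 1 by rewrite /p /m; lra.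
  have F2 : p * d + m * c = 0 by rewrite /p /m; lra.
  have F3 : c * (p ^+ 2 + m ^+ 2) = p.
    have -> : c * (p ^+ 2 + m ^+ 2) = p * (p * c - m * d) + m * (p * d + m * c) by ring.
    by rewrite F1 F2 mulr0 addr0 mulr1.
  have F4 : p ^+ 2 + m ^+ 2 <= p * (1 + s).
    rewrite /p /m.
    have v1 : -1 <= v by have := sqr_ge0 w; nra.
    rewrite -subr_ge0.
    have -> : (1 - s * v) * (1 + s) - ((1 - s * v) ^+ 2 + (- (s * w)) ^+ 2) =
      s * ((1 - s) * (1 + v) + s * (1 - (v ^+ 2 + w ^+ 2))) by ring.
    by rewrite mulr_ge0 ?(ltW s0) // addr_ge0 // mulr_ge0 ?(ltW s0) //; lra.
  have F5 : 0 < p ^+ 2 + m ^+ 2.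
    rewrite lt_def addr_ge0 ?sqr_ge0 // andbT; apply/eqP => F.
    have F6 : p = 0 by rewrite -F3 F mulr0.
    have F7 : m = 0.
      by apply/eqP; rewrite -sqrf_eq0 -F F6 expr0n /= add0r.
    by move: F1; rewrite F6 F7 !mul0r subrr => /eqP; rewrite eq_sym oner_eq0.
  rewrite subr_ge0 -(ler_pM2r F5) F3.
  apply: le_trans (_ : k * (p * (1 + s)) <= _); first by rewrite ler_wpM2l // ltW.
  by rewrite mulrCA ks mulr1.
have a0 : a 0%N = ofR (1 - k).
  by rewrite /a /g expr0 mulr1 ofRB ofRN.
have := @convolution_Re_ge0 a q (1 - k) y ha hq a0 pa pq y1.
have -> : ps (fun n => a n * q n) y = ps q z - ofR k * q 0%N.
  have hgq := PS_hadamard hg hq; have hdq := PS_hadamard hd hq.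
  rewrite (@eq_ps _ _ (fun n => g n * q n + ofR (- k) * (delta0 n * q n))); last first.
    by move=> n; rewrite /a mulrDl mulrA.
  rewrite ps_add // ?ps_scale //; last exact: PS_scale.
  rewrite ps_deltaM.
  rewrite ofRN mulNr; congr (_ - _); rewrite ps.unlock zE; congr (limn (series _)).
  by apply/funext => n; rewrite [(ofR s * y) ^+ n]exprMn /g [RHS]mulrCA mulrA.
rewrite ReD ReB !ReZ => H.
have k1 : k < 1 by rewrite invf_lt1; lra.
have k2 : 0 < 1 - 2 * (1 - k) by nra.
have := mulr_gt0 k2 q00; lra.
Qed.

End ConvolutionPositivity2.

(** * Starlikeness by convolution *)

Section Starlike.
Variable R : realType.
Implicit Types (a e : nat -> Cplx R) (z w p eps : Cplx R).

Lemma ivt01 (f : R -> R) (v : R) : (forall t : R, 0 <= t <= 1 -> f x @[x --> t] --> f t) ->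
  v < f 0 -> f 1 <= v -> exists2 t, 0 <= t <= 1 & f t = v.
Proof.
move=> cf f0 f1.
have cf' : {within `[0, 1], continuous f}.
  apply: continuous_in_subspaceT => t; rewrite inE /= in_itv /= => t01.
  exact: cf.
have [|t] := @IVT _ f 0 1 v ler01 cf'.
  by rewrite ge_min le_max (ltW f0) f1 orbT.
by rewrite in_itv /= => t01 ft; exists t.
Qed.

Lemma cvg_ray z (t : R) : ofR x * z @[x --> t] --> ofR t * z.
Proof. by apply: cvgCM; [apply: cvg_ofR; exact: cvg_id|exact: cvgC_cst]. Qed.

Lemma cabs_ray z (t : R) : cabs z < 1 -> 0 <= t <= 1 -> cabs (ofR t * z) < 1.
Proof.
move=> z1 /andP[t0 t1]; apply: le_lt_trans z1.
by rewrite cabsM cabs_ofR ger0_norm // ler_piMl // cabs_ge0.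
Qed.

Lemma ps_ray a z (t : R) : PS a -> cabs z < 1 -> 0 <= t <= 1 ->
  ps a (ofR x * z) @[x --> t] --> ps a (ofR t * z).
Proof. by move=> ha z1 t01; apply: ps_cvg_comp => //; [exact: cabs_ray|exact: cvg_ray]. Qed.

Lemma cabs_sqr z : cabs z ^+ 2 = complex.Re z ^+ 2 + complex.Im z ^+ 2.
Proof. by rewrite cabs.unlock; case: z => x y /=; rewrite sqr_sqrtr // addr_ge0 ?sqr_ge0. Qed.

(** The imaginary axis is equidistant from 1 and -1. *)
Lemma cabs_Re0 p : (cabs (p + 1) == cabs (p - 1)) = (complex.Re p == 0).
Proof.
rewrite -(eqrXn2 (n := 2)) ?cabs_ge0 // !cabs_sqr !ReD !ImD /=.
by apply/eqP/eqP; lra.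
Qed.

(** The coefficients of h_eps(z)/z; the family of the h_eps detects starlikeness
    because convolution with h_eps gives (1+eps)/2 z f' + (1-eps)/2 f. *)
Definition heps_coef eps (n : nat) : Cplx R := 1 + (1 + eps) / 2 * n%:R.

Lemma ps_heps_coefM e eps z : PS e -> cabs z < 1 ->
  ps (fun n => heps_coef eps n * e n) z =
  (1 + eps) / 2 * ps (fun n => n.+1%:R * e n) z + (1 - eps) / 2 * ps e z.
Proof.
move=> he z1; have hn := PS_natmul he.
rewrite -!ps_scale // -ps_add //; try exact: PS_scale.
apply: eq_ps => n; rewrite mulrA -mulrDl; congr (_ * _).
by rewrite /heps_coef -nat1r; field.
Qed.

Lemma PS_heps_coefM e eps : PS e -> PS (fun n => heps_coef eps n * e n).
Proof.
apply: (@PS_le _ _ _ (1 + cabs ((1 + eps) / 2))) => n.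
rewrite cabsM ler_wpM2r ?cabs_ge0 // /heps_coef.
apply: le_trans (cabsD _ _) _; rewrite cabs1 cabsM cabs_nat -natr1.
have := cabs_ge0 ((1 + eps) / 2); have : (0 : R) <= n%:R by [].
nra.
Qed.

(** With N = z f' and D = f divided by z, the convolution with h_eps vanishes at
    z exactly when p = N/D satisfies p + 1 = - eps (p - 1) (or when D = 0, for
    eps = -1), so that the nonvanishing for all eps says that p never meets the
    imaginary axis.  Since p = 1 at the origin, the intermediate value theorem
    along the segment from 0 to z keeps p in the right half-plane. *)
Lemma starlike_crit e : PS e -> e 0%N = 1 ->
  (forall z, cabs z < 1 -> z != 0 ->
     0 < complex.Re (ps (fun n => n.+1%:R * e n) z / ps e z)) <->
  (forall eps, cabs eps = 1 -> forall z, cabs z < 1 ->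
     ps (fun n => heps_coef eps n * e n) z != 0).
Proof.
move=> he e0; have hn := PS_natmul he; split=> [H eps eps1 z z1|H].
  have [->|z0] := eqVneq z 0; first by rewrite ps0 /heps_coef e0 mulr0 addr0 mul1r oner_neq0.
  have := H z z1 z0; rewrite ps_heps_coefM //.
  move: (ps _ z) (ps e z) => N D; have [->|D0] := eqVneq D 0.
    by rewrite invr0 mulr0 /= ltxx.
  set p := N / D => p0; apply/negP => /eqP E.
  have E2 : p + 1 = - eps * (p - 1).
    have : (1 + eps) * N + (1 - eps) * D = 0.
      have -> : (1 + eps) * N + (1 - eps) * D =
        2 * ((1 + eps) / 2 * N + (1 - eps) / 2 * D) by field.
      by rewrite E mulr0.
    have -> : N = p * D by rewrite /p divfK.
    move=> E3; apply: (mulIf D0); apply/eqP; rewrite -subr_eq0 -E3; apply/eqP; ring.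
  have : cabs (p + 1) == cabs (p - 1) by rewrite E2 cabsM cabsN eps1 mul1r.
  by rewrite cabs_Re0 gt_eqF.
have D0 z : cabs z < 1 -> ps e z != 0.
  move=> z1; have := H (-1) _ z z1; rewrite cabsN cabs1 ps_heps_coefM // subrr mul0r mul0r add0r.
  by move=> /(_ erefl); apply: contra => /eqP ->; rewrite mulr0.
set p := fun z => ps (fun n => n.+1%:R * e n) z / ps e z.
have p0 z : cabs z < 1 -> complex.Re (p z) != 0.
  move=> z1; apply/negP; rewrite -cabs_Re0 => /eqP E.
  (* Otherwise eps = - (p + 1)/(p - 1) is unimodular and gives a zero. *)
  have pm1 : p z - 1 != 0.
    apply/eqP => pE; move: E; rewrite pE cabs0 => /eqP; rewrite cabs_eq0.
    have -> : p z + 1 = 2 by rewrite -(subrK 1 (p z)) pE add0r.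
    by rewrite pnatr_eq0.
  have := H (- ((p z + 1) / (p z - 1))) _ z z1; rewrite cabsN cabsM cabsV E.
  rewrite divff ?cabs_eq0 // => /(_ erefl)/eqP; apply.
  rewrite ps_heps_coefM //.
  have -> : ps (fun n => n.+1%:R * e n) z = p z * ps e z by rewrite /p divfK ?D0.
  move: (p z) pm1 (ps e z) => q q1 d; field.
  exact: q1.
move=> z z1 z0; rewrite ltNge; apply/negP => neg.
have [|||t t01 /eqP] := @ivt01 (fun t => complex.Re (p (ofR t * z))) 0.
- move=> t t01; apply: cvg_Re; apply: cvgCM; first exact: ps_ray.
  apply: cvgV; first by apply: D0; exact: cabs_ray.
  exact: ps_ray.
- by rewrite mul0r /p !ps0 e0 mulr1 divr1 ltr01.
- by rewrite mul1r.
by apply/negP; apply: p0; exact: cabs_ray.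
Qed.

End Starlike.

(** * The duality principle *)

Section Duality.
Variable R : realType.
Implicit Types (a c e p : nat -> Cplx R) (z w eps : Cplx R) (f F : Cplx R -> Cplx R).

Definition denom (mu nu : R) (n : nat) : R := (1 + mu * n%:R) * (1 + nu * n%:R).

Lemma denom_ge1 mu nu n : 0 < mu -> 0 < nu -> 1 <= denom mu nu n.
Proof.
move=> m0 n0; have h : (0 : R) <= n%:R by [].
by rewrite /denom -[X in X <= _]mulr1 ler_pM // lerDl mulr_ge0 // ltW.
Qed.

Lemma denom0 mu nu : denom mu nu 0 = 1.
Proof. by rewrite /denom !mulr0 addr0 mulr1. Qed.

Lemma PS_quad_le a (C : R) (s : nat -> Cplx R) : PS a ->
  (forall n, cabs (s n) <= C * n.+1%:R * n.+1%:R) -> PS (fun n => s n * a n).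
Proof.
move=> ha hs; apply: (@PS_le _ _ _ C _ (PS_natmul ha)) => n.
by rewrite !cabsM cabs_nat [in leRHS]mulrA ler_wpM2r ?cabs_ge0.
Qed.

(** The differential operator acts on z^(n+1) by the factor
    1 + (alpha - gamma) n + gamma n^2, and the relations between the parameters
    are made to factor this as (1 + mu n)(1 + nu n). *)
Lemma classW_ps (alpha gamma mu nu beta : R) f a z :
  mu + nu = alpha - gamma -> mu * nu = gamma ->
  is_ps f a -> a 0%N = 0 -> cabs z < 1 ->
  ofR (1 - alpha + 2 * gamma) * overz f z + ofR (alpha - 2 * gamma) * derive1 f z
  + ofR gamma * z * derive1 (derive1 f) z - ofR beta =
  ps (fun n => ofR (denom mu nu n) * a n.+1) z - ofR beta.
Proof.
move=> hs hp fa a0 z1; congr (_ - _).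
have [ha _] := fa; have hsh := PS_shift ha; have hd := PS_d ha.
have [hz hzE] := is_ps_mulz (is_ps_derive1 (is_ps_derive1 fa)).
have [_ hd1] := is_ps_derive1 fa.
rewrite (overz_ps fa a0 z1) hd1 // -mulrA hzE //.
rewrite -!ps_scale // -!ps_add //; try (by exact: PS_scale); last first.
  by apply: PS_add; exact: PS_scale.
apply: eq_ps => n; rewrite /dps.
have -> : zps (fun n => n.+1%:R * (n.+2%:R * a n.+2)) n = ofR (n%:R * n.+1%:R) * a n.+1.
  case: n => [|n] /=; first by rewrite mul0r ofR0 mul0r.
  by rewrite ofRM !ofR_nat mulrA.
rewrite -ofR_nat !mulrA -!ofRM -!mulrDl -!ofRD; congr (ofR _ * _).
have ga : gamma = mu * nu by [].
have al : alpha = mu + nu + mu * nu by rewrite hs hp; ring.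
by rewrite /denom al ga -nat1r; ring.
Qed.

Lemma pascu_ps (xi : R) F c : is_ps F c -> c 0%N = 0 -> c 1%N = 1 ->
  pascu xi F <-> forall z, cabs z < 1 -> z != 0 ->
    0 < complex.Re (ps (fun n => n.+1%:R * (ofR (1 + xi * n%:R) * c n.+1)) z /
      ps (fun n => ofR (1 + xi * n%:R) * c n.+1) z).
Proof.
move=> Fc c0 c1.
have [hc FE] := Fc; have [hd dE] := is_ps_derive1 Fc; have hsh := PS_shift hc.
have [hdd ddE] := is_ps_derive1 (is_ps_mulz (is_ps_derive1 Fc)).
have E z : cabs z < 1 -> z != 0 ->
    (ofR xi * z * derive1 (fun w => w * derive1 F w) z + ofR (1 - xi) * z * derive1 F z)
       / (ofR xi * z * derive1 F z + ofR (1 - xi) * F z) =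
    ps (fun n => n.+1%:R * (ofR (1 + xi * n%:R) * c n.+1)) z /
      ps (fun n => ofR (1 + xi * n%:R) * c n.+1) z.
  move=> z1 z0; rewrite ddE // dE // (is_ps_divz Fc c0 z1).
  have -> : ofR xi * z * ps (dps (zps (dps c))) z + ofR (1 - xi) * z * ps (dps c) z =
    z * ps (fun n => n.+1%:R * (ofR (1 + xi * n%:R) * c n.+1)) z.
    rewrite -[ofR xi * z * _]mulrA -[ofR (1 - xi) * z * _]mulrA mulrCA.
    rewrite [ofR (1 - xi) * _]mulrCA -mulrDr; congr (_ * _).
    rewrite -!ps_scale // -ps_add //; try exact: PS_scale.
    apply: eq_ps => n; rewrite /dps /=.
    have -> : ofR (1 + xi * n%:R) = ofR xi * n.+1%:R + ofR (1 - xi).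
      by rewrite -ofR_nat -ofRM -ofRD -nat1r; congr ofR; ring.
    ring.
  have -> : ofR xi * z * ps (dps c) z + ofR (1 - xi) * (z * ps (fun n => c n.+1) z) =
    z * ps (fun n => ofR (1 + xi * n%:R) * c n.+1) z.
    rewrite -mulrA mulrCA [ofR (1 - xi) * _]mulrCA -mulrDr; congr (_ * _).
    rewrite -!ps_scale // -ps_add //; try exact: PS_scale.
    apply: eq_ps => n; rewrite /dps /=.
    have -> : ofR (1 + xi * n%:R) = ofR xi * n.+1%:R + ofR (1 - xi).
      by rewrite -ofR_nat -ofRM -ofRD -nat1r; congr ofR; ring.
    ring.
  by rewrite -mulf_div divff // mul1r.
split=> [[_ H] z z1 z0|H]; first by rewrite -E // H // ltR_norm1.
split; first by apply/classA_ps; exists c.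
by move=> z; rewrite ltR_norm1 => z1 z0; rewrite E // H.
Qed.

(** For w = 1/(1 - z) one has w - 1 = z w, so that w is nearer to 1 than to 0. *)
Lemma Re_inv1B z : cabs z < 1 -> 1 < 2 * complex.Re ((1 - z)^-1).
Proof.
move=> z1; have z0 : 1 - z != 0.
  by apply: contraTneq z1 => /subr0_eq <-; rewrite cabs1 ltxx.
set w := (1 - z)^-1.
have w0 : w != 0 by rewrite invr_eq0.
have : cabs (w - 1) < cabs w.
  have -> : w - 1 = z * w by apply: (mulIf z0); rewrite mulrBl -mulrA mulVf //; ring.
  by rewrite cabsM gtr_pMl // cabs_gt0.
move=> h; have : cabs (w - 1) ^+ 2 < cabs w ^+ 2 by rewrite ltr_pXn2r // nnegrE cabs_ge0.
rewrite !cabs_sqr ReB ImB /=.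
lra.
Qed.

Lemma expi_atan (x : R) : expi (- atan x) = ofR ((Num.sqrt (1 + x ^+ 2))^-1) * Complex 1 (- x).
Proof.
have c0 : cos (atan x) != 0.
  rewrite cos_atan invr_eq0 sqrtr_eq0 -ltNge.
  by rewrite ltr_pwDl // sqr_ge0.
have sE : sin (atan x) = x * cos (atan x) by rewrite -{2}(atanK x) /tan divfK.
apply: eq_Cplx; rewrite ?ReZ ?ImZ /= ?cosN ?sinN -cos_atan ?mulr1 //.
by rewrite sE mulrN mulrC.
Qed.

Variables (alpha gamma xi mu nu rho beta B : R) (tau : nat -> R).
Hypotheses (hxi : 0 <= xi <= 1) (hmu : 0 < mu) (hnu : 0 < nu).
Hypotheses (hsum : mu + nu = alpha - gamma) (hprod : mu * nu = gamma).
Hypotheses (hrho : rho < 1) (hbeta : beta < 1).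
Hypothesis hB : B * (2 * (1 - beta) * (1 - rho)) = 1.
Hypothesis htau : forall n, 0 <= tau n <= 1.

(** The coefficients of the kernel of the operator, with moments abstracted to
    an arbitrary sequence [tau] in [0, 1]. *)
Definition kernel_coef n : Cplx R :=
  match n with 0 => 0 | 1 => 1 | m.+1 => ofR ((1 - rho) * tau m) end.

Variable V : (Cplx R -> Cplx R) -> (Cplx R -> Cplx R).
Hypothesis hV : forall f a, is_ps f a -> is_ps (V f) (fun n => kernel_coef n * a n).

(** The series which the duality principle tests.  Its constant term 2B is
    chosen so that its Hadamard product with the normalized series P below is
    2B times the convolution of the image of f with h_eps. *)
Definition dual_coef eps n : Cplx R :=
  if n == 0%N then ofR (2 * B)
  else ofR (tau n * (1 + xi * n%:R) / denom mu nu n) * heps_coef eps n.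

Let B0 : 0 < B.
Proof.
have h : 0 < 2 * (1 - beta) * (1 - rho) by rewrite !mulr_gt0 ?subr_gt0.
by rewrite -(pmulr_lgt0 _ h) hB.
Qed.

Lemma denom_gt0 n : 0 < denom mu nu n.
Proof. by apply: lt_le_trans (denom_ge1 n hmu hnu). Qed.

Lemma PS_dual_coef eps : PS (dual_coef eps).
Proof.
have h1 : PS (fun _ => 1 : Cplx R) by apply: (@PS_bounded _ _ 1) => n; rewrite cabs1.
pose k n : Cplx R := if n == 0%N then ofR (2 * B)
  else ofR (tau n * (1 + xi * n%:R) / denom mu nu n).
have hk : PS k.
  apply: (@PS_le _ _ _ (1 + `|2 * B|) _ h1) => n; rewrite cabs1 mulr1 /k.
  have n0 : (1 : R) <= n.+1%:R by rewrite ler1n.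
  case: eqP => [_|_]; rewrite cabs_ofR; first by have := normr_ge0 (2 * B); nra.
  have [t0 t1] := andP (htau n); have [x0 x1] := andP hxi.
  have d0 := denom_gt0 n; have d1 := denom_ge1 n hmu hnu.
  have m0 : (0 : R) <= n%:R by [].
  rewrite ger0_norm; last by rewrite divr_ge0 ?(ltW d0) // mulr_ge0 // addr_ge0 // mulr_ge0.
  rewrite ler_pdivrMr //.
  apply: (@le_trans _ _ n.+1%:R).
    have : 1 + xi * n%:R <= n.+1%:R by rewrite -nat1r lerD2l ler_piMl.
    have : 0 <= 1 + xi * n%:R by rewrite addr_ge0 // mulr_ge0.
    nra.
  have : 0 <= `|2 * B| by [].
  set b := `|2 * B| => b0.
  have : n.+1%:R <= (1 + b) * n.+1%:R by nra.
  have : 0 <= (1 + b) * n.+1%:R by nra.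
  nra.
have hE : PS (fun n => heps_coef eps n * k n) by exact: PS_heps_coefM.
have -> // : dual_coef eps = fun n => heps_coef eps n * k n.
apply/funext => -[|n]; rewrite /dual_coef /k /=; last by rewrite mulrC.
by rewrite /heps_coef mulr0 addr0 mul1r.
Qed.

(** The coefficients of P = (H - beta)/(1 - beta), where H is the differential
    expression in the definition of the class W; P(0) = 1 and the class is the
    condition that exp(i phi) P has positive real part. *)
Definition carath_coef a n : Cplx R :=
  if n == 0%N then 1 else ofR (denom mu nu n / (1 - beta)) * a n.+1.

Lemma PS_denom a : PS a -> PS (fun n => ofR (denom mu nu n) * a n).
Proof.
move=> ha; apply: (@PS_quad_le _ ((1 + mu) * (1 + nu))) => // n.
rewrite cabs_ofR gtr0_norm ?denom_gt0 // /denom -nat1r.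
have n0 : (0 : R) <= n%:R by [].
have -> : (1 + mu) * (1 + nu) * (1 + n%:R) * (1 + n%:R) =
  ((1 + mu) * (1 + n%:R)) * ((1 + nu) * (1 + n%:R)) by ring.
have key (m : R) : 0 < m -> 0 <= 1 + m * n%:R <= (1 + m) * (1 + n%:R).
  move=> m0; rewrite addr_ge0 ?mulr_ge0 ?(ltW m0) //=.
  have -> : (1 + m) * (1 + n%:R) = 1 + m * n%:R + (m + n%:R) by ring.
  by rewrite lerDl addr_ge0 // ltW.
have /andP[m1 m2] := key mu hmu; have /andP[n1 n2] := key nu hnu.
exact: ler_pM.
Qed.

Lemma PS_carath_coef a : PS a -> PS (carath_coef a).
Proof.
move=> ha.
have h1 : PS (fun n => ofR (denom mu nu n) * a n.+1) by exact: PS_denom (PS_shift ha).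
have hd := @PS_delta0 R.
have := PS_add (PS_scale (1 - a 1%N / ofR (1 - beta)) hd) (PS_scale (ofR (1 - beta)^-1) h1).
congr PS; apply/funext => -[|n]; rewrite /carath_coef /delta0 /=.
  by rewrite denom0 mulr1 mul1r ofRV [_^-1 * _]mulrC subrK.
by rewrite mulr0 add0r mulrA -ofRM [_^-1 * _]mulrC.
Qed.

Lemma classW_carath_coef a z : PS a -> a 1%N = 1 -> cabs z < 1 ->
  ps (fun n => ofR (denom mu nu n) * a n.+1) z - ofR beta = ofR (1 - beta) * ps (carath_coef a) z.
Proof.
move=> ha a1 z1.
have b1 : 1 - beta != 0 by rewrite gt_eqF // subr_gt0.
rewrite ps_shift //; last exact: PS_denom (PS_shift ha).
rewrite (ps_shift (PS_carath_coef ha)) // /carath_coef /= denom0 a1 !mulr1 mulrDr mulr1.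
rewrite addrAC -ofRB; congr (_ + _); rewrite mulrCA; congr (_ * _).
rewrite -ps_scale //; last exact: (PS_shift (PS_carath_coef ha)).
by apply: eq_ps => n; rewrite mulrA -ofRM mulrCA divff // mulr1.
Qed.

Definition starlike_coef a n : Cplx R := ofR (1 + xi * n%:R) * (kernel_coef n.+1 * a n.+1).

Lemma heps_starlike_coef eps a n : a 1%N = 1 ->
  heps_coef eps n * starlike_coef a n = ofR (2 * B)^-1 * (dual_coef eps n * carath_coef a n).
Proof.
move=> a1; have B2 : 2 * B != 0 by rewrite gt_eqF // mulr_gt0.
case: n => [|n]; rewrite /starlike_coef /dual_coef /carath_coef /=.
  by rewrite /heps_coef !mulr0 !addr0 ofR1 a1 !mulr1 -ofRM mulVf.
have b1 : 1 - beta != 0 by rewrite gt_eqF // subr_gt0.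
have b2 : 1 - rho != 0 by rewrite gt_eqF // subr_gt0.
have d0 := lt0r_neq0 (denom_gt0 n.+1).
have -> : (2 * B)^-1 = (1 - beta) * (1 - rho).
  by apply: (mulfI B2); rewrite divff // -[LHS]hB; ring.
transitivity (ofR ((1 + xi * n.+1%:R) * ((1 - rho) * tau n.+1)) *
    (heps_coef eps n.+1 * a n.+2)).
  by rewrite ofRM mulrCA -!mulrA; congr (_ * _); rewrite mulrCA.
have key (x y w : R) (c b : Cplx R) :
    ofR x * (ofR y * c * (ofR w * b)) = ofR (x * y * w) * (c * b).
  by rewrite !ofRM; ring.
rewrite key.
congr (ofR _ * _); field.
by rewrite d0 b1.
Qed.

Lemma PS_starlike_coef a : PS a -> PS (starlike_coef a).
Proof.
move=> ha; have [hka _] := hV (is_ps_id ha).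
apply: (@PS_le _ _ _ 1 _ (PS_shift hka)) => n.
rewrite /starlike_coef cabsM ler_wpM2r ?cabs_ge0 // cabs_ofR mul1r.
have [x0 x1] := andP hxi; have n0 : (0 : R) <= n%:R by [].
rewrite ger0_norm ?addr_ge0 ?mulr_ge0 // -nat1r lerD2l.
by rewrite ler_piMl.
Qed.

(** The starlikeness criterion for xi z F' + (1 - xi) F, F being the image of f:
    convolved with h_eps, it is 1/(2B) times the Hadamard product of P with
    [dual_coef]. *)
Lemma pascu_V f a : is_ps f a -> a 0%N = 0 -> a 1%N = 1 ->
  pascu xi (V f) <-> forall eps, cabs eps = 1 -> forall z, cabs z < 1 ->
    ps (fun n => dual_coef eps n * carath_coef a n) z != 0.
Proof.
move=> fa a0 a1; have [ha _] := fa.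
have c1 : kernel_coef 1 * a 1%N = 1 by rewrite mul1r.
rewrite (@pascu_ps xi _ _ (hV fa)) ?mul0r //.
have e0 : starlike_coef a 0 = 1 by rewrite /starlike_coef mulr0 addr0 ofR1 mul1r.
have he := PS_starlike_coef ha.
rewrite (starlike_crit he e0).
have B2 : ofR (2 * B)^-1 != 0.
  by rewrite -cabs_eq0 cabs_ofR normr_eq0 invr_eq0 gt_eqF // mulr_gt0.
have E eps z : cabs z < 1 -> ps (fun n => heps_coef eps n * starlike_coef a n) z =
  ofR (2 * B)^-1 * ps (fun n => dual_coef eps n * carath_coef a n) z.
  move=> z1; rewrite -ps_scale //; last by apply: PS_hadamard; [exact: PS_dual_coef|exact: PS_carath_coef].
  by apply: eq_ps => n; exact: heps_starlike_coef.
split=> H eps eps1 z z1.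
  by have := H eps eps1 z z1; rewrite E // mulf_eq0 negb_or => /andP[].
by rewrite E // mulf_eq0 negb_or B2 H.
Qed.

Lemma dual_coef_shiftE eps : (fun n => if n == 0%N then ofR B else dual_coef eps n) =
  fun n => dual_coef eps n + ofR (- B) * delta0 R n.
Proof.
apply/funext => -[|n]; rewrite /dual_coef /delta0 /=; last by rewrite mulr0 addr0.
by rewrite mulr1 -ofRD; congr ofR; ring.
Qed.

Lemma ps_dual_coef_shift eps z : cabs z < 1 ->
  ps (fun n => if n == 0%N then ofR B else dual_coef eps n) z = ps (dual_coef eps) z - ofR B.
Proof.
move=> z1; have hK := PS_dual_coef eps; have hd := @PS_delta0 R.
rewrite dual_coef_shiftE ps_add //; last exact: PS_scale.
by rewrite ps_scale // ps_delta0 mulr1 ofRN.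
Qed.

Definition dual_halfplane : Prop := forall eps, cabs eps = 1 -> forall z, cabs z < 1 ->
  B <= complex.Re (ps (dual_coef eps) z).

(** Removing B from the constant term 2B leaves a series K of nonnegative real
    part with K(0) = B, and K * Q + K(0) Q(0) for Q = exp(i phi) P is the Hadamard
    product of the full series with Q.  It thus has nonnegative real part by
    [convolution_Re_ge0], and positive real part by [harnack] since it is
    2B exp(i phi) at the origin; in particular it does not vanish. *)
Lemma dual_halfplane_pascu f : dual_halfplane -> classW beta alpha gamma f -> pascu xi (V f).
Proof.
move=> hK [/classA_ps[a [fa a0 a1]] [phi hW]].
have [ha _] := fa; have hp := PS_carath_coef ha.
apply/(pascu_V fa a0 a1) => eps eps1 z z1.
have b1 : 0 < 1 - beta by rewrite subr_gt0.
pose q n := expi phi * carath_coef a n.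
have hq : PS q by exact: PS_scale.
have q0 w : cabs w < 1 -> 0 < complex.Re (ps q w).
  move=> w1; have := hW w; rewrite ltR_norm1 => /(_ w1).
  rewrite (@classW_ps _ _ _ _ _ _ _ _ hsum hprod fa a0 w1) classW_carath_coef //.
  by rewrite mulrCA ReZ pmulr_rgt0 // ps_scale.
pose A n := if n == 0%N then ofR B else dual_coef eps n.
have hKt := PS_dual_coef eps.
have hd := @PS_delta0 R.
have hA : PS A by rewrite /A dual_coef_shiftE; apply: PS_add => //; exact: PS_scale.
have hKq : PS (fun n => dual_coef eps n * q n) by exact: PS_hadamard.
have hAq : PS (fun n => A n * q n) by exact: PS_hadamard.
have Kq0 w : cabs w < 1 -> 0 <= complex.Re (ps (fun n => dual_coef eps n * q n) w).
  move=> w1.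
  have := @convolution_Re_ge0 _ A q B w hA hq erefl _ (fun u u1 => ltW (q0 u u1)) w1.
  have -> : ps (fun n => A n * q n) w + ofR B * q 0%N = ps (fun n => dual_coef eps n * q n) w.
    rewrite (ps_shift hAq) // (ps_shift hKq) // addrAC; congr (_ + _).
    by rewrite /A /dual_coef /= -mulrDl -ofRD; congr (ofR _ * _); ring.
  by apply => u u1; rewrite ps_dual_coef_shift // ReB /= subr_ge0 hK.
have K0 : 0 < complex.Re (dual_coef eps 0%N * q 0%N).
  have -> : dual_coef eps 0%N = ofR (2 * B) by [].
  rewrite ReZ pmulr_rgt0 ?mulr_gt0 //.
  by have := q0 0; rewrite cabs0 ps0; apply.
have := harnack hKq Kq0 z1 K0; apply: contraTneq => E.
rewrite (@eq_ps _ _ (fun n => expi phi * (dual_coef eps n * carath_coef a n))); last first.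
  by move=> n; rewrite /q mulrCA.
rewrite ps_scale; [by rewrite E mulr0 /= ltxx| |by []].
exact: PS_hadamard.
Qed.

(** If the real part drops below B, it equals B at some point z by the
    intermediate value theorem, the value there being B (1 + i x).  The series P
    with coefficients 1, c, c, ... and c = 2/(1 - i x) is a Moebius
    transformation of the disk onto a half-plane whose boundary contains 0:
    (1 - i x) P(w) = 2/(1 - w) - (1 + i x) has positive real part.  The Hadamard
    product with P is 2B (1 - c) + c B (1 + i x) = 0 at z. *)
Lemma pascu_dual_halfplane : (forall f, classW beta alpha gamma f -> pascu xi (V f)) -> dual_halfplane.
Proof.
move=> H eps eps1 z0 z01; rewrite leNgt; apply/negP => neg.
have hK := PS_dual_coef eps.
have [|||t t01 ft] := @ivt01 R (fun t => complex.Re (ps (dual_coef eps) (ofR t * z0))) B.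
- by move=> t t01; apply: cvg_Re; exact: ps_ray.
- by rewrite mul0r ps0 /dual_coef /=; have := B0; lra.
- by rewrite mul1r ltW.
have z1 := cabs_ray z01 t01; set z := ofR t * z0 in ft z1.
(* The boundary value is B (1 + i x), and d = 1 - i x directs the half-plane. *)
pose x := complex.Im (ps (dual_coef eps) z) / B.
have KE : ps (dual_coef eps) z = ofR B * Complex 1 x.
  apply: eq_Cplx; rewrite ?ReZ ?ImZ /= ?mulr1 //.
  by rewrite /x mulrCA divff ?mulr1 // gt_eqF.
pose d : Cplx R := Complex 1 (- x).
have d0 : d != 0 by rewrite eq_complex /= oner_eq0.
have dc : Complex 1 x = 2 - d :> Cplx R by apply: eq_Cplx; rewrite ?ReB ?ImB /=; ring.
pose c : Cplx R := 2 / d.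
have dcE : d * c = 2 by rewrite /c mulrC divfK.
have b1 : 0 < 1 - beta by rewrite subr_gt0.
pose a n : Cplx R :=
  match n with 0 => 0 | 1 => 1 | m.+1 => ofR ((1 - beta) / denom mu nu m) * c end.
have ha : PS a.
  apply: (@PS_bounded _ _ (1 + (1 - beta) * cabs c)) => -[|[|n]]; rewrite /a.
  - by rewrite cabs0 addr_ge0 // mulr_ge0 ?(ltW b1) ?cabs_ge0.
  - by rewrite cabs1 lerDl mulr_ge0 ?(ltW b1) ?cabs_ge0.
  have d1 := denom_ge1 n.+1 hmu hnu; have d2 := denom_gt0 n.+1.
  rewrite cabsM cabs_ofR gtr0_norm ?divr_gt0 //.
  apply: (@le_trans _ _ ((1 - beta) * cabs c)); last by rewrite lerDr.
  by rewrite ler_wpM2r ?cabs_ge0 // ler_pdivrMr // ler_peMr // ltW.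
have pE : carath_coef a = fun n => delta0 R n * (1 - c) + c.
  apply/funext => -[|n]; rewrite /carath_coef /delta0 /=; first by rewrite mul1r subrK.
  rewrite mul0r add0r mulrA -ofRM [X in ofR X](_ : _ = 1) ?ofR1 ?mul1r //.
  by field; rewrite ?gt_eqF ?denom_gt0.
have fa := is_ps_id ha; have hp := PS_carath_coef ha.
have /H/(pascu_V fa erefl erefl)/(_ eps eps1 z z1)/eqP : classW beta alpha gamma (ps a).
  split; first by apply/classA_ps; exists a.
  exists (- atan x) => w; rewrite ltR_norm1 => w1.
  rewrite (@classW_ps _ _ _ _ _ _ _ _ hsum hprod fa erefl w1) classW_carath_coef //.
  rewrite expi_atan -mulrA ReZ pmulr_rgt0; last first.
    by rewrite invr_gt0 sqrtr_gt0 ltr_pwDl // sqr_ge0.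
  rewrite mulrCA ReZ pmulr_rgt0 // -/d.
  have w0 : 1 - w != 0.
    by apply: contraTneq w1 => /subr0_eq <-; rewrite cabs1 ltxx.
  have P1 : (1 - w) * ps (carath_coef a) w = 1 + w * (c - 1).
    rewrite ps_diff //; congr (_ + _ * _).
    rewrite (@eq_ps _ _ (fun n => delta0 R n * (c - 1))) ?(ps_deltaM (fun=> c - 1)) //.
    by move=> n; rewrite pE /delta0 /=; case: eqP => _; ring.
  have -> : d * ps (carath_coef a) w = 2 * (1 - w)^-1 - Complex 1 x.
    apply: (mulfI w0); rewrite mulrCA P1 [RHS]mulrBr [X in _ = X - _]mulrCA divff // mulr1 dc.
    have -> : d * (1 + w * (c - 1)) = d + w * (d * c - d) by ring.
    by rewrite dcE; ring.
  rewrite ReB /=; have := Re_inv1B w1.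
  have -> : 2 * (1 - w)^-1 = ofR 2 * (1 - w)^-1 by rewrite ofR_nat.
  by rewrite ReZ; lra.
apply.
have -> : (fun n => dual_coef eps n * carath_coef a n) =
    fun n => c * dual_coef eps n + ofR (2 * B) * (1 - c) * delta0 R n.
  apply/funext => n; rewrite pE mulrDr addrC [dual_coef _ _ * c]mulrC; congr (_ + _).
  by case: n => [|n]; rewrite /dual_coef /delta0 /= ?mul0r ?mulr0 // mul1r mulr1.
rewrite ps_add //; try exact: PS_scale; last by apply: PS_scale; exact: PS_delta0.
rewrite !ps_scale //; last exact: PS_delta0.
rewrite ps_delta0 mulr1 KE dc ofRM ofR_nat.
have -> : c * (ofR B * (2 - d)) + 2 * ofR B * (1 - c) = ofR B * (2 - d * c) by ring.
by rewrite dcE subrr mulr0.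
Qed.

End Duality.

(** * Integrals of powers *)

Section PowerIntegral.
Variable R : realType.
Notation leb := (@lebesgue_measure R).

Lemma integral_powR_away (s a x : R) : (0 < s)%R -> (0 < a)%R -> (a < x)%R ->
  (\int[leb]_(t in `[a, x]) (t `^ (s - 1))%:E = (x `^ s / s - a `^ s / s)%:E)%E.
Proof.
move=> s0 a0 ax.
have dF (t : R) : (0 < t -> is_derive t 1 (fun t => t `^ s / s) (t `^ (s - 1)))%R.
  move=> t0; have h := is_derive1_powR s t0.
  have -> : (t `^ (s - 1) = s^-1 *: (s * t `^ (s - 1)))%R.
    by rewrite /GRing.scale /= mulrA mulVf ?mul1r // gt_eqF.
  have -> : (fun t => t `^ s / s)%R = (s^-1 \*: (fun t => t `^ s))%R.
    by apply/funext => u /=; rewrite mulrC.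
  exact: is_deriveZ.
have cF (t : R) : (0 < t)%R -> {for t, continuous (fun t : R => t `^ s / s)%R}.
  move=> t0; apply: differentiable_continuous; apply/derivable1_diffP.
  by have [] := dF t t0.
have c1 (t : R) : (0 < t)%R -> {for t, continuous (fun t : R => t `^ (s - 1))%R}.
  move=> t0; apply: differentiable_continuous; apply/derivable1_diffP.
  by have [] := is_derive1_powR (s - 1) t0.
rewrite (@continuous_FTC2 _ _ (fun t => t `^ s / s)%R) ?EFinB //.
- apply: continuous_in_subspaceT => t; rewrite inE /= in_itv /= => /andP[at_ _].
  by apply: c1; exact: lt_le_trans at_.
- split.
  + move=> t; rewrite in_itv /= => /andP[at_ _].
    by have [] := dF t (lt_trans a0 at_).
  + by apply: cvg_at_right_filter; exact: cF.
  + by apply: cvg_at_left_filter; apply: cF; exact: lt_trans ax.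
- move=> t; rewrite in_itv /= => /andP[at_ _].
  by rewrite derive1E; have [_ ->] := dF t (lt_trans a0 at_).
Qed.

(** The integrand is unbounded near 0 when s < 1; the integrals over
    [x/(n+2), x] increase to the integral by monotone convergence. *)
Lemma integral_powR (s x : R) : (0 < s)%R -> (0 <= x)%R ->
  (\int[leb]_(t in `[0%R, x]) (t `^ (s - 1))%:E = (x `^ s / s)%:E)%E.
Proof.
move=> s0; rewrite le_eqVlt => /predU1P[<-|x0].
  by rewrite set_itv1 integral_set1 powR0 ?mul0r // gt_eqF.
have mp (A : set R) : measurable_fun A (EFin \o (fun t : R => (t `^ (s - 1))%R)).
  apply: measurable_funTS.
  by apply/measurable_EFinP.
rewrite -integral_itv_obnd_cbnd; last by [].
pose a n : R := (x / n.+2%:R)%R.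
have a0 n : (0 < a n)%R by rewrite divr_gt0.
have ax n : (a n < x)%R by rewrite /a ltr_pdivrMr // ltr_pMr // ltr1n.
have and_ n m : (n <= m)%N -> (a m <= a n)%R.
  by move=> nm; rewrite /a ler_pM2l // lef_pV2 ?posrE // ler_nat.
pose g n (t : R) : \bar R := if (a n <= t)%R then (t `^ (s - 1))%:E else 0%E.
have mg n : measurable_fun setT (g n).
  by apply: measurable_fun_ifT; [exact: measurable_fun_ler|exact: mp|exact: measurable_cst].
have cg : (fun n => (\int[leb]_(t in `]0%R, x]) g n t)%E) @ \oo -->
   (\int[leb]_(t in `]0%R, x]) (t `^ (s - 1))%:E)%E.
  rewrite [X in _ --> X](_ : _ = \int[leb]_(t in `]0%R, x]) limn (g ^~ t))%E.
    apply: cvg_monotone_convergence => //.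
    - by move=> n; apply: measurable_funTS; exact: mg.
    - by move=> n t _; rewrite /g; case: ifP => // _; rewrite lee_fin powR_ge0.
    - move=> t _ n m nm; rewrite /g; case: ifP => [h|_].
        by rewrite (le_trans (and_ _ _ nm) h).
      by case: ifP => // _; rewrite lee_fin powR_ge0.
  apply: eq_integral => t; rewrite inE /= in_itv /= => /andP[t0 tx].
  apply/esym/cvg_lim => //; apply: cvg_near_cst.
  have [N hN] : exists N, (a N <= t)%R.
    exists (Num.truncn (x / t)); rewrite /a ler_pdivrMr // mulrC -ler_pdivrMr //.
    by apply: (ltW (lt_trans (truncnS_gt _) _)); rewrite ltr_nat.
  exists N => // n /= Nn; rewrite /g ifT //; exact: le_trans (and_ _ _ Nn) hN.
have ig n : (\int[leb]_(t in `]0%R, x]) g n t)%E = (x `^ s / s - a n `^ s / s)%:E.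
  rewrite -(@integral_powR_away s (a n) x) //.
  rewrite -(setIidr (_ : `[a n, x]%classic `<=` `]0%R, x]%classic)); last first.
    by apply: subset_itvr; rewrite bnd_simp.
  rewrite integral_mkcondr; apply: eq_integral => t; rewrite inE /= in_itv /= => /andP[t0 tx].
  by rewrite /g patchE mem_setE in_itv /= tx andbT.
rewrite (funext ig) in cg.
apply: (cvg_unique (@ereal_hausdorff R) cg).
apply: cvg_EFin; first by apply: nearW.
rewrite [X in X @ _ --> _](_ : _ = fun n => x `^ s / s - a n `^ s / s)%R //.
rewrite -[X in _ --> X]subr0; apply: cvgB; first exact: cvg_cst.
rewrite -[X in _ --> X](mul0r s^-1); apply: cvgM; last exact: cvg_cst.
have a_0 : a @ \oo --> 0%R.
  rewrite /a -(mulr0 x); apply: cvgM; first exact: cvg_cst.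
  rewrite (cvg_shiftS (fun n => (n.+1%:R)^-1 : R)); exact: cvg_harmonic.
have := powR_cvg0 s0; move=> /cvgrPdist_lt h; apply/cvgrPdist_lt => e e0.
have := h e e0; rewrite near_withinE => -[d /= d0 hd].
have /cvgrPdist_lt/(_ d d0) := a_0.
by apply: filterS => n hn; apply: hd.
Qed.

End PowerIntegral.

(** * Moments of tail integrals *)

Section TailMoments.
Variable R : realType.
Notation leb := (@lebesgue_measure R).
Notation I01 := (`[(0:R), (1:R)]%classic).
Variable (w : R -> R).
Hypothesis w0 : forall x, 0 <= x <= 1 -> 0 <= w x.
Hypothesis mw : measurable_fun I01 w.

(** The integrand of both iterated integrals over the triangle
    0 <= t <= x <= 1, extended by zero. *)
Let kernel (s : R) (p : R * R) : \bar R :=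
  if (0 <= p.1) && (p.1 <= p.2) then ((p.1 `^ (s - 1) * (w \_ I01) p.2)%R)%:E else 0%E.

Let mW : measurable_fun setT (w \_ I01).
Proof. by apply/(measurable_restrictT _ _).1. Qed.

Let W0 x : 0 <= (w \_ I01) x.
Proof.
rewrite patchE; case: ifPn => // ; rewrite mem_setE in_itv /=.
exact: w0.
Qed.

Let measurable_kernel s : measurable_fun setT (kernel s).
Proof.
apply: measurable_fun_ifT.
- apply: measurable_and; apply: measurable_fun_ler => //.
- apply/measurable_EFinP; apply: measurable_funM.
    exact: (measurableT_comp (measurable_powR (s - 1)) measurable_fst).
  exact: (measurableT_comp mW measurable_snd).
- exact: measurable_cst.
Qed.

Let kernel_ge0 s p : (0 <= kernel s p)%E.
Proof. by rewrite /kernel; case: ifP => // _; rewrite lee_fin mulr_ge0 ?powR_ge0. Qed.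

Let tailbar (t : R) : \bar R := (\int[leb]_(x in `[t, 1%R]) (w x)%:E)%E.

Let kernel_left s t : (\int[leb]_x kernel s (t, x))%E =
  (((fun t => (t `^ (s - 1))%:E * tailbar t) \_ I01) t)%E.
Proof.
rewrite patchE; case: ifPn; rewrite mem_setE in_itv /=; last first.
  move=> t01; rewrite integral0_eq // => x _; rewrite /kernel /=.
  case: ifP => // /andP[t0 tx]; rewrite patchE; case: ifPn; last by rewrite mulr0.
  rewrite mem_setE in_itv /= => /andP[x0 x1].
  by move: t01; rewrite t0 (le_trans tx x1).
move=> /andP[t0 t1].
rewrite -ge0_integralZl_EFin ?powR_ge0 //; last 2 first.
- move=> x; rewrite /= in_itv /= => /andP[tx x1]; rewrite lee_fin w0 // x1 andbT.
  exact: le_trans tx.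
- apply/measurable_EFinP; apply: measurable_funS mw => //.
  by apply: subset_itvr; rewrite bnd_simp.
rewrite [RHS]integral_mkcond; apply: eq_integral => x _.
rewrite /kernel /= t0 /= !patchE !mem_setE !in_itv /=.
case: (leP t x) => //= tx; rewrite (le_trans t0 tx) /=.
by case: ifP => // _; rewrite mulr0.
Qed.

Let kernel_right s x : 0 < s -> (\int[leb]_t kernel s (t, x))%E =
  (((fun x => (w x * (x `^ s / s))%:E) \_ I01) x)%E.
Proof.
move=> s0; rewrite patchE; case: ifPn; rewrite mem_setE in_itv /=; last first.
  move=> x01; rewrite integral0_eq // => t _; rewrite /kernel /=.
  have -> : (w \_ I01) x = 0 by rewrite patchE mem_setE in_itv /= (negPf x01).
  by rewrite mulr0 if_same.
move=> x01; have [x0 x1] := andP x01.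
rewrite EFinM -(integral_powR s0 x0) -ge0_integralZl_EFin ?w0 //; last 2 first.
- by move=> t _; rewrite lee_fin powR_ge0.
- by apply/measurable_EFinP; apply: measurable_funTS.
rewrite [RHS]integral_mkcond; apply: eq_integral => t _.
rewrite /kernel /= !patchE !mem_setE !in_itv /= x01.
by case: ifP => // _; rewrite -EFinM mulrC.
Qed.

Let tonelli s : 0 < s ->
  (\int[leb]_(t in I01) ((t `^ (s - 1))%:E * tailbar t) =
   \int[leb]_(x in I01) (w x * (x `^ s / s))%:E)%E.
Proof.
move=> s0; rewrite integral_mkcond [RHS]integral_mkcond.
have := @fubini_tonelli _ _ _ _ R leb leb (kernel s) (measurable_kernel s) (kernel_ge0 s).
rewrite (funext (kernel_left s)) (funext (fun x => @kernel_right s x s0)).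
by [].
Qed.

Let tailbar_ge0 t : 0 <= t -> (0 <= tailbar t)%E.
Proof.
move=> t0; apply: integral_ge0 => x; rewrite /= in_itv /= => /andP[tx x1].
by rewrite lee_fin w0 // x1 (le_trans t0 tx).
Qed.

Let mtail1 : measurable_fun I01 tailbar.
Proof.
have := measurable_fun_fubini_tonelli_F (m2 := leb) _ (measurable_kernel 1) (kernel_ge0 1).
rewrite /fubini_F (funext (kernel_left 1)).
move=> /(measurable_funTS (D := I01)).
apply: eq_measurable_fun => t; rewrite inE /= => t01.
by rewrite patchE mem_set // subrr powRr0 mul1e.
Qed.

Definition tail (t : R) : R := \int[leb]_(x in `[t, 1]) w x.

Lemma tail_ge0 t : 0 <= t -> 0 <= tail t.
Proof. by move=> t0; rewrite fine_ge0 // tailbar_ge0. Qed.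

Lemma measurable_tail : measurable_fun I01 tail.
Proof. exact: measurableT_comp mtail1. Qed.

(** Tonelli's theorem over 0 <= t <= x <= 1, the inner integral of t^(s-1) over
    [0, x] being x^s/s.  The finiteness hypothesis makes the tail finite for
    almost every t, where its real value agrees with the extended one. *)
Lemma tail_moment s : 0 < s ->
  (\int[leb]_(x in I01) (w x * x `^ s)%:E < +oo)%E ->
  (\int[leb]_(t in I01) (t `^ (s - 1) * tail t)%:E =
   \int[leb]_(x in I01) (w x * (x `^ s / s))%:E)%E.
Proof.
move=> s0 fin; rewrite -tonelli //.
have mpw : measurable_fun I01 (fun t : R => (t `^ (s - 1))%:E).
  by apply/measurable_EFinP; exact: measurable_funTS.
have mK : measurable_fun I01 (fun t => (t `^ (s - 1))%:E * tailbar t)%E.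
  by apply: emeasurable_funM.
have iK : leb.-integrable I01 (fun t => (t `^ (s - 1))%:E * tailbar t)%E.
  apply/integrableP; split=> //.
  rewrite [X in (X < _)%E](_ : _ =
      \int[leb]_(t in I01) ((t `^ (s - 1))%:E * tailbar t))%E; last first.
    apply: eq_integral => t; rewrite inE /= in_itv /= => /andP[t0 t1].
    by rewrite gee0_abs // mule_ge0 ?tailbar_ge0 // lee_fin powR_ge0.
  rewrite tonelli //.
  rewrite [X in (X < _)%E](_ : _ =
      \int[leb]_(x in I01) ((s^-1)%:E * (w x * x `^ s)%:E))%E; last first.
    by apply: eq_integral => x _; rewrite -EFinM; congr EFin; ring.
  rewrite ge0_integralZl_EFin //.
  - by rewrite lte_mul_pinfty // lee_fin invr_ge0 ltW.
  - by move=> x; rewrite /= in_itv /= => x01; rewrite lee_fin mulr_ge0 ?w0 ?powR_ge0.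
  - apply/measurable_EFinP; apply: measurable_funM => //; exact: measurable_funTS.
  - by rewrite invr_ge0 ltW.
apply: ae_eq_integral => //.
  apply/measurable_EFinP; apply: measurable_funM; last exact: measurable_tail.
  exact: measurable_funTS.
have := integrable_ae _ iK; move=> /(_ (measurable_itv _)).
move=> [N [mN N0 hN]].
exists (N `|` [set 0]); split.
- by apply: measurableU => //; exact: measurable_set1.
- apply: null_set_setU => //; exact: (@lebesgue_measure_set1 R 0).
move=> t /= /not_implyP[t01]; apply: contra_notP => /not_orP[tN t0].
have : (fun t => I01 t -> ((t `^ (s - 1))%:E * tailbar t)%E \is a fin_num) t.
  by apply: contrapT => h; apply: tN; apply: hN.
move=> /(_ t01) f.
move: (t01); rewrite /= in_itv /= => /andP[t0' t1].
have p0 : 0 < t `^ (s - 1) by rewrite powR_gt0 // lt_def t0' andbT; apply/eqP.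
have tf : tailbar t \is a fin_num.
  move: f (tailbar_ge0 t0'); case: (tailbar t) => [r| |] //=.
  by rewrite gt0_muley.
by rewrite EFinM /tail /Rintegral fineK.
Qed.

End TailMoments.

(** * The moments of the weight in N *)

Section Moments.
Variable R : realType.
Notation leb := (@lebesgue_measure R).
Notation I01 := (`[(0:R), (1:R)]%classic).

Lemma eq_integral01 (f g : R -> \bar R) : measurable_fun I01 f -> measurable_fun I01 g ->
  (forall x, 0 < x <= 1 -> f x = g x) ->
  (\int[leb]_(x in I01) f x = \int[leb]_(x in I01) g x)%E.
Proof.
move=> mf mg fg.
have sub : (`](0:R), (1:R)]%classic `<=` I01) by apply: subset_itvr; rewrite bnd_simp.
rewrite -integral_itv_obnd_cbnd; last exact: measurable_funS mf.
rewrite -[RHS]integral_itv_obnd_cbnd; last exact: measurable_funS mg.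
by apply: eq_integral => x; rewrite inE /= in_itv /= => /fg.
Qed.

Variables (mu nu : R) (lam : R -> R).
Hypotheses (hmu : 0 < mu) (hnu : 0 < nu).
Hypothesis hlam0 : forall t : R, 0 <= t <= 1 -> 0 <= lam t.
Hypothesis hlami : leb.-integrable I01 (fun t : R => (lam t)%:E).
Hypothesis hlam1 : \int[leb]_(t in I01) lam t = 1.

Let mlam : measurable_fun I01 lam.
Proof. by apply/measurable_EFinP; have /integrableP[] := hlami. Qed.

Let mX n : measurable_fun I01 (fun t : R => t ^+ n).
Proof. by apply: measurable_funTS; exact: measurable_funX. Qed.

Let mP s : measurable_fun I01 (fun t : R => t `^ s).
Proof. exact: measurable_funTS. Qed.

Definition tau n : R := \int[leb]_(t in I01) (lam t * t ^+ n).

Lemma integrable_lamX n : leb.-integrable I01 (fun t : R => (lam t * t ^+ n)%:E).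
Proof.
apply: le_integrable hlami => //.
  by apply/measurable_EFinP; exact: measurable_funM.
move=> t; rewrite /= in_itv /= => /andP[t0 t1].
have l0 : 0 <= lam t by rewrite hlam0 // t0.
rewrite lee_fin !ger0_norm ?mulr_ge0 ?exprn_ge0 //.
by rewrite ler_piMr // exprn_ile1.
Qed.

Lemma tau0 : tau 0 = 1.
Proof. by rewrite -hlam1; apply: eq_Rintegral => t _; rewrite expr0 mulr1. Qed.

Lemma tau01 n : 0 <= tau n <= 1.
Proof.
apply/andP; split.
  apply: Rintegral_ge0 => t; rewrite /= in_itv /= => /andP[t0 t1].
  by rewrite mulr_ge0 ?exprn_ge0 // hlam0 // t0.
rewrite -hlam1; apply: le_Rintegral => //; first exact: integrable_lamX.
move=> t; rewrite /= in_itv /= => /andP[t0 t1].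
by rewrite ler_piMr ?exprn_ile1 // hlam0 // t0.
Qed.

Lemma tauE n : (\int[leb]_(t in I01) (lam t * t ^+ n)%:E)%E = (tau n)%:E.
Proof. by rewrite /tau /Rintegral fineK // integrable_fin_num // integrable_lamX. Qed.

Let w1 (x : R) := lam x / (x `^ nu^-1).
Let w2 (x : R) := Lambda lam nu x * x `^ (nu^-1 - 1 - mu^-1).

Let w10 x : 0 <= x <= 1 -> 0 <= w1 x.
Proof. by move=> x01; rewrite mulr_ge0 ?hlam0 // invr_ge0 powR_ge0. Qed.

Let mw1 : measurable_fun I01 w1.
Proof.
apply: (@eq_measurable_fun _ _ _ _ _ (fun x => lam x * x `^ (- nu^-1))).
  by move=> x _; rewrite /w1 powRN.
by apply: measurable_funM => //; exact: mP.
Qed.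

Let w20 x : 0 <= x <= 1 -> 0 <= w2 x.
Proof.
move=> /andP[x0 x1]; rewrite mulr_ge0 ?powR_ge0 //.
exact: (tail_ge0 w10).
Qed.

Let mw2 : measurable_fun I01 w2.
Proof. by apply: measurable_funM; [exact: (measurable_tail w10 mw1)|exact: mP]. Qed.

(** Both [Lambda] and [Pi] are tails, so that [tail_moment] applies twice; the
    exponents of the weights are those for which the powers cancel. *)
Let moment1 n : (\int[leb]_(t in I01) (w1 t * t `^ (nu^-1 + n%:R))%:E)%E = (tau n)%:E.
Proof.
rewrite -tauE; apply: eq_integral01.
- by apply/measurable_EFinP; apply: measurable_funM; [exact: mw1|exact: mP].
- by apply/measurable_EFinP; apply: measurable_funM; [exact: mlam|exact: mX].
move=> x /andP[x0 x1]; congr EFin; rewrite /w1 powRD ?(lt0r_neq0 x0) ?implybT //.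
by rewrite powR_mulrn ?(ltW x0) // mulrA divfK // gt_eqF // powR_gt0.
Qed.

Let s1_gt0 n : 0 < nu^-1 + n%:R. Proof. by rewrite ltr_wpDr // invr_gt0. Qed.
Let s2_gt0 n : 0 < mu^-1 + n%:R. Proof. by rewrite ltr_wpDr // invr_gt0. Qed.

Let moment2 n : (\int[leb]_(t in I01) (t `^ (nu^-1 + n%:R - 1) * Lambda lam nu t)%:E)%E =
  (tau n / (nu^-1 + n%:R))%:E.
Proof.
rewrite (tail_moment w10 mw1 (s1_gt0 n)); last by rewrite moment1 ltry.
rewrite mulrC EFinM -moment1 -ge0_integralZl_EFin ?invr_ge0 ?(ltW (s1_gt0 n)) //.
- by apply: eq_integral => x _; rewrite -EFinM; congr EFin; ring.
- by move=> x; rewrite /= in_itv /= => x01; rewrite lee_fin mulr_ge0 ?w10 ?powR_ge0.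
- by apply/measurable_EFinP; apply: measurable_funM; [exact: mw1|exact: mP].
Qed.

Let moment3 n : (\int[leb]_(t in I01) (w2 t * t `^ (mu^-1 + n%:R))%:E)%E =
  (tau n / (nu^-1 + n%:R))%:E.
Proof.
rewrite -moment2; apply: eq_integral01.
- by apply/measurable_EFinP; apply: measurable_funM; [exact: mw2|exact: mP].
- by apply/measurable_EFinP; apply: measurable_funM; [exact: mP|exact: (measurable_tail w10 mw1)].
move=> x /andP[x0 x1]; congr EFin; rewrite /w2 -mulrA -powRD ?(lt0r_neq0 x0) ?implybT //.
by rewrite mulrC; congr (_ `^ _ * _); ring.
Qed.

Let moment4 n : (\int[leb]_(t in I01) (t `^ (mu^-1 + n%:R - 1) * Pi lam mu nu t)%:E)%E =
  (tau n / (nu^-1 + n%:R) / (mu^-1 + n%:R))%:E.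
Proof.
rewrite (tail_moment w20 mw2 (s2_gt0 n)); last by rewrite moment3 ltry.
rewrite mulrC EFinM -moment3 -ge0_integralZl_EFin ?invr_ge0 ?(ltW (s2_gt0 n)) //.
- by apply: eq_integral => x _; rewrite -EFinM; congr EFin; ring.
- by move=> x; rewrite /= in_itv /= => x01; rewrite lee_fin mulr_ge0 ?w20 ?powR_ge0.
- by apply/measurable_EFinP; apply: measurable_funM; [exact: mw2|exact: mP].
Qed.

Definition kappa t : R := t `^ (mu^-1 - 1) * Pi lam mu nu t.

Lemma kappa_ge0 t : 0 <= t -> 0 <= kappa t.
Proof. by move=> t0; rewrite mulr_ge0 ?powR_ge0 //; exact: (tail_ge0 w20). Qed.

Lemma measurable_kappa : measurable_fun I01 kappa.
Proof. by apply: measurable_funM; [exact: mP|exact: (measurable_tail w20 mw2)]. Qed.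

Lemma kappa_moment n : (\int[leb]_(t in I01) (kappa t * t ^+ n)%:E)%E =
  (mu * nu * (tau n / denom mu nu n))%:E.
Proof.
have -> : mu * nu * (tau n / denom mu nu n) = tau n / (nu^-1 + n%:R) / (mu^-1 + n%:R).
  have h1 := lt0r_neq0 (s1_gt0 n); have h2 := lt0r_neq0 (s2_gt0 n).
  have h3 := lt0r_neq0 hmu; have h4 := lt0r_neq0 hnu.
  have -> : denom mu nu n = (mu * (mu^-1 + n%:R)) * (nu * (nu^-1 + n%:R)).
    by rewrite /denom !mulrDr !divff.
  move: (nu^-1 + n%:R) (mu^-1 + n%:R) h1 h2 => p q p0 q0.
  by field; rewrite h3 h4 p0 q0.
rewrite -moment4; apply: eq_integral01.
- by apply/measurable_EFinP; apply: measurable_funM => //; exact: measurable_kappa.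
- by apply/measurable_EFinP; apply: measurable_funM; [exact: mP|exact: (measurable_tail w20 mw2)].
move=> x /andP[x0 x1]; congr EFin; rewrite /kappa mulrAC -powR_mulrn ?(ltW x0) //.
rewrite -powRD ?(lt0r_neq0 x0) ?implybT //.
by congr (_ `^ _ * _); ring.
Qed.

Lemma integrable_kappa : leb.-integrable I01 (fun t => (kappa t)%:E).
Proof.
apply/integrableP; split; first by apply/measurable_EFinP; exact: measurable_kappa.
rewrite [X in (X < _)%E](_ : _ = \int[leb]_(t in I01) (kappa t * t ^+ 0)%:E)%E.
  by rewrite kappa_moment ltry.
apply: eq_integral => t; rewrite inE /= in_itv /= => /andP[t0 _].
by rewrite expr0 mulr1 ger0_norm // kappa_ge0.
Qed.

End Moments.

(** * Integration of power series *)

Section Dominated.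
Variable R : realType.
Notation leb := (@lebesgue_measure R).
Notation I01 := (`[(0:R), (1:R)]%classic).

(** Convergence and domination are only asked on [0, 1[: the series in the
    integrands may diverge at 1. *)
Lemma dominated01 (f_ : nat -> R -> R) (f g : R -> R) :
  (forall n, measurable_fun I01 (f_ n)) ->
  (forall t, 0 <= t < 1 -> f_ n t @[n --> \oo] --> f t) ->
  leb.-integrable I01 (fun t => (g t)%:E) ->
  (forall n t, 0 <= t < 1 -> `|f_ n t| <= g t) ->
  leb.-integrable I01 (fun t => (f t)%:E) /\
  \int[leb]_(t in I01) f_ n t @[n --> \oo] --> \int[leb]_(t in I01) f t.
Proof.
move=> mf_ cf ig dom.
pose J := (`[(0:R), (1:R)[%classic).
have sub : J `<=` I01 by apply: subset_itvl; rewrite bnd_simp.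
have mJ : measurable J by exact: measurable_itv.
have mfJ n : measurable_fun J (fun t => (f_ n t)%:E).
  by apply/measurable_EFinP; apply: measurable_funS (mf_ n).
have cfJ t : J t -> (f_ n t)%:E @[n --> \oo] --> (f t)%:E.
  by rewrite /J /= in_itv /= => t01; apply: cvg_EFin; [exact: nearW|exact: cf].
have mf : measurable_fun J (fun t => (f t)%:E).
  by apply: emeasurable_fun_cvg cfJ => // n; exact: mfJ.
have igJ : leb.-integrable J (fun t => (g t)%:E) by apply: integrableS ig.
have [iJ _ cJ] : [/\ leb.-integrable J (fun t => (f t)%:E),
    [sequence \int[leb]_(t in J) `|(f_ n t)%:E - (f t)%:E|]_n @ \oo --> 0 &
    [sequence \int[leb]_(t in J) (f_ n t)%:E]_n @ \oo --> \int[leb]_(t in J) (f t)%:E]%E.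
  apply: (@dominated_convergence _ _ _ leb J mJ (fun n t => (f_ n t)%:E) _ (fun t => (g t)%:E)) => //.
  - by apply: aeW => t; exact: cfJ.
  - by apply: aeW => t n; rewrite /J /= in_itv /= lee_fin; exact: dom.
have mI : measurable_fun I01 (fun t => (f t)%:E).
  exact/emeasurable_fun_itv_bndo_bndcP.
have iI : leb.-integrable I01 (fun t => (f t)%:E).
  apply/integrableP; split=> //.
  have /integrableP[_] := iJ.
  by rewrite integral_itv_bndo_bndc //; exact: measurableT_comp.
split=> //.
have cI : (\int[leb]_(t in I01) (f_ n t)%:E)%E @[n --> \oo] -->
    (\int[leb]_(t in I01) f t)%:E.
  have -> : (\int[leb]_(t in I01) f t)%:E = (\int[leb]_(t in J) (f t)%:E)%E.
    rewrite integral_itv_bndo_bndc // /Rintegral fineK //.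
    exact: integrable_fin_num.
  apply: cvg_trans cJ; apply: near_eq_cvg; apply: nearW => n /=.
  exact: integral_itv_bndo_bndc.
exact: fine_cvg cI.
Qed.

(** The partial sums are dominated by |g| times the sum of the |a_n||z|^n. *)
Lemma integral_ps (g : R -> R) (a : nat -> Cplx R) (z : Cplx R) :
  leb.-integrable I01 (fun t => (g t)%:E) -> PS a -> cabs z < 1 ->
  leb.-integrable I01 (fun t => (g t * complex.Re (ps a (ofR t * z)))%:E) /\
  \int[leb]_(t in I01) (g t * complex.Re (ps a (ofR t * z))) =
  complex.Re (ps (fun n => ofR (\int[leb]_(t in I01) (g t * t ^+ n)) * a n) z).
Proof.
move=> ig ha z1.
have mg : measurable_fun I01 g by apply/measurable_EFinP; have /integrableP[] := ig.
have mX n : measurable_fun I01 (fun t : R => t ^+ n).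
  by apply: measurable_funTS; exact: measurable_funX.
have igX n : leb.-integrable I01 (fun t => (g t * t ^+ n)%:E).
  apply: le_integrable ig => //.
    by apply/measurable_EFinP; apply: measurable_funM; [exact: mg|exact: mX].
  move=> t; rewrite /= in_itv /= => /andP[t0 t1].
  by rewrite lee_fin normrM ler_piMr // ger0_norm ?exprn_ge0 // exprn_ile1.
have z01 : 0 <= cabs z < 1 by rewrite cabs_ge0.
have cA := PS_sum ha z01.
set A := series _ in cA.
pose L := limn A.
have AL n : A n <= L.
  apply: nondecreasing_cvgn_le => //; apply: nondecreasing_series => k _ _.
  by rewrite mulr_ge0 ?cabs_ge0 ?exprn_ge0 ?cabs_ge0.
pose b n := complex.Re (a n * z ^+ n).
have bA n : `|b n| <= cabs (a n) * cabs z ^+ n.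
  by rewrite (le_trans (le_Re_cabs _)) // cabsM cabsX.
pose f_ n t := g t * \sum_(0 <= k < n) b k * t ^+ k.
have mf_ n : measurable_fun I01 (f_ n).
  apply: measurable_funM; first exact: mg.
  apply: measurable_sum => k; apply: measurable_funM; last exact: mX.
  exact: measurable_cst.
have cf t : 0 <= t < 1 -> f_ n t @[n --> \oo] --> g t * complex.Re (ps a (ofR t * z)).
  move=> /andP[t0 t1]; apply: cvgM; first exact: cvg_cst.
  have tz1 : cabs (ofR t * z) < 1 by apply: cabs_ray => //; rewrite t0 ltW.
  apply: eq_cvgn (cvg_Re (ps_cvg ha tz1)) => n.
  rewrite /series /= Re_sum; apply: eq_bigr => k _.
  by rewrite /b exprMn -ofRX mulrCA ReZ mulrC.
have iL : leb.-integrable I01 (fun t => (`|g t| * L)%:E).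
  have -> : (fun t => (`|g t| * L)%:E) = (fun t => L%:E * `|(g t)%:E|)%E.
    by apply/funext => t; rewrite mulrC EFinM.
  by apply: integrableZl => //; exact: integrable_abse ig.
have dom n t : 0 <= t < 1 -> `|f_ n t| <= `|g t| * L.
  move=> /andP[t0 t1]; rewrite normrM ler_wpM2l //.
  apply: le_trans (AL n); apply: le_trans (ler_norm_sum _ _ _) _.
  apply: ler_sum => k _; rewrite normrM (ger0_norm (exprn_ge0 _ t0)).
  apply: le_trans (bA k); rewrite ler_piMr //.
  by rewrite exprn_ile1 // ltW.
have [iI cI] := dominated01 mf_ cf iL dom; split=> //.
have hm : PS (fun n => ofR (\int[leb]_(t in I01) (g t * t ^+ n)) * a n).
  pose M := \int[leb]_(t in I01) `|g t|.
  have hc : PS (fun n => ofR (\int[leb]_(t in I01) (g t * t ^+ n))).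
    apply: (@PS_bounded _ _ M) => n; rewrite cabs_ofR.
    apply: le_trans (le_normr_Rintegral _ (igX n)) _ => //.
    apply: le_Rintegral => //; [exact: integrable_abse (igX n)|exact: integrable_abse ig|].
    move=> t; rewrite /= in_itv /= => /andP[t0 t1].
    by rewrite normrM ler_piMr // ger0_norm ?exprn_ge0 // exprn_ile1.
  exact: PS_hadamard.
apply: (cvg_unique (@Rhausdorff R) cI).
apply: eq_cvgn (cvg_Re (ps_cvg hm z1)) => n.
rewrite /series /= Re_sum.
rewrite /f_; elim: n => [|n IH].
  rewrite big_nil; under eq_Rintegral do rewrite big_nil mulr0.
  by rewrite Rintegral_cst // mul0r.
have ib m : leb.-integrable I01 (EFin \o (fun t => g t * \sum_(0 <= k < m) b k * t ^+ k)).
  apply: le_integrable iL => //.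
    by apply/measurable_EFinP; exact: mf_.
  move=> t; rewrite /= in_itv /= => /andP[t0 t1].
  rewrite lee_fin normrM [X in _ <= X]ger0_norm; last first.
    by rewrite mulr_ge0 //; apply: le_trans (AL 0%N); rewrite /A /series /= big_nil.
  rewrite ler_wpM2l //; apply: le_trans (AL m); apply: le_trans (ler_norm_sum _ _ _) _.
  apply: ler_sum => k _; rewrite normrM (ger0_norm (exprn_ge0 _ t0)).
  by apply: le_trans (bA k); rewrite ler_piMr // exprn_ile1.
rewrite big_nat_recr //= IH.
transitivity (\int[leb]_(t in I01) (g t * (\sum_(0 <= k < n) b k * t ^+ k) + b n * (g t * t ^+ n))).
  rewrite RintegralD //; last first.
    rewrite [X in integrable _ _ X](_ : _ = (fun t => (b n)%:E * (g t * t ^+ n)%:E)%E).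
      by apply: integrableZl => //; exact: igX.
    by apply/funext => t; rewrite /= EFinM.
  rewrite RintegralZl //; last exact: igX.
  by congr (_ + _); rewrite -mulrA ReZ mulrC.
apply: eq_Rintegral => t _; rewrite big_nat_recr //= mulrDr; congr (_ + _).
by rewrite mulrCA.
Qed.

End Dominated.

(** * The rational kernels *)

Section Kernels.
Variable R : realType.
Notation leb := (@lebesgue_measure R).
Notation I01 := (`[(0:R), (1:R)]%classic).
Implicit Types (z u eps : Cplx R).

Let one (n : nat) : Cplx R := 1.

Lemma PS_one : PS one.
Proof. by apply: (@PS_bounded _ _ 1) => n; rewrite cabs1. Qed.

Lemma neq1_disk z : cabs z < 1 -> 1 - z != 0.
Proof. by move=> z1; apply: contraTneq z1 => /subr0_eq <-; rewrite cabs1 ltxx. Qed.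

Lemma ps_zero z : ps (fun=> 0) z = 0.
Proof.
apply: ps_lim; apply: eq_cvgn (@cvgC_cst _ _ _ _ 0) => n.
by rewrite /series /= big1 // => i _; rewrite mul0r.
Qed.

Lemma ps_one z : cabs z < 1 -> (1 - z) * ps one z = 1.
Proof.
move=> z1; rewrite ps_diff //; last exact: PS_one.
by rewrite (@eq_ps _ _ (fun=> 0)) ?ps_zero ?mulr0 ?addr0 // => n; rewrite subrr.
Qed.

Lemma ps_cst (k : Cplx R) z : cabs z < 1 -> (1 - z) * ps (fun=> k) z = k.
Proof.
move=> z1; rewrite (@eq_ps _ _ (fun n => k * one n)); last by move=> n; rewrite mulr1.
by rewrite ps_scale //; [rewrite mulrCA ps_one // mulr1|exact: PS_one].
Qed.

Lemma PS_nat1 : PS (fun n => n.+1%:R : Cplx R).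
Proof. by have := PS_natmul PS_one; congr PS; apply/funext => n; rewrite mulr1. Qed.

Lemma PS_nat1sq : PS (fun n => n.+1%:R ^+ 2 : Cplx R).
Proof. by have := PS_natmul PS_nat1; congr PS; apply/funext => n; rewrite expr2. Qed.

Lemma ps_nat1 z : cabs z < 1 -> (1 - z) ^+ 2 * ps (fun n => n.+1%:R) z = 1.
Proof.
move=> z1; rewrite expr2 -mulrA ps_diff //; last exact: PS_nat1.
rewrite (@eq_ps _ _ one); last by move=> n; rewrite -natr1 addrC addKr.
by rewrite mulrDr mulrCA ps_one // !mulr1 subrK.
Qed.

Lemma ps_nat1sq z : cabs z < 1 -> (1 - z) ^+ 3 * ps (fun n => n.+1%:R ^+ 2) z = 1 + z.
Proof.
move=> z1; rewrite exprSr -mulrA ps_diff //; last exact: PS_nat1sq.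
have h2 : PS (fun n => 2 * n.+1%:R : Cplx R) by apply: PS_scale; exact: PS_nat1.
rewrite (@eq_ps _ (fun n => n.+2%:R ^+ 2 - n.+1%:R ^+ 2) (fun n => 2 * n.+1%:R + one n)).
  rewrite ps_add //; [|exact: PS_one]; rewrite ps_scale //; last exact: PS_nat1.
  have -> : (1 - z) ^+ 2 * (1 ^+ 2 + z * (2 * ps (fun n => n.+1%:R) z + ps one z)) =
    (1 - z) ^+ 2 + z * (2 * ((1 - z) ^+ 2 * ps (fun n => n.+1%:R) z) +
      (1 - z) * ((1 - z) * ps one z)) by ring.
  by rewrite ps_nat1 // ps_one //; ring.
by move=> n; rewrite /one -[n.+2%:R]natr1; ring.
Qed.

Lemma PS_heps_coef eps : PS (heps_coef eps).
Proof.
by have := PS_heps_coefM eps PS_one; congr PS; apply/funext => n; rewrite mulr1.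
Qed.

Lemma ps_heps_coef eps z : cabs z < 1 ->
  ps (heps_coef eps) z = (1 + (eps - 1) / 2 * z) / (1 - z) ^+ 2.
Proof.
move=> z1; have z0 := neq1_disk z1.
rewrite (@eq_ps _ _ (fun n => heps_coef eps n * one n)); last by move=> n; rewrite mulr1.
rewrite ps_heps_coefM //; last exact: PS_one.
rewrite (@eq_ps _ (fun n => n.+1%:R * one n) (fun n => n.+1%:R)); last by move=> n; rewrite mulr1.
apply: (mulIf (expf_neq0 2 z0)); rewrite divfK ?expf_neq0 // mulrC.
have -> : (1 - z) ^+ 2 * ((1 + eps) / 2 * ps (fun n => n.+1%:R) z + (1 - eps) / 2 * ps one z)
  = (1 + eps) / 2 * ((1 - z) ^+ 2 * ps (fun n => n.+1%:R) z)
    + (1 - eps) / 2 * (1 - z) * ((1 - z) * ps one z) by ring.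
by rewrite ps_nat1 // ps_one //; field.
Qed.

Lemma is_ps_heps eps : is_ps (heps eps) (zps (heps_coef eps)).
Proof.
apply: eq_is_ps (is_ps_mulz (is_ps_id (PS_heps_coef eps))) => // z z1.
by rewrite ps_heps_coef // /heps mulrA.
Qed.

(** The coefficients of (1-xi) h(z)/z + xi h'(z) for the Koebe function
    h = z/(1-z)^2.  Its value at -t is (1-xi)/(1+t)^2 + xi (1-t)/(1+t)^3, which is
    what the definition of N subtracts. *)
Definition koebe_coef (xi : R) n : Cplx R := ofR (n.+1%:R * (1 + xi * n%:R)).

Lemma PS_koebe_coef xi : PS (koebe_coef xi).
Proof.
apply: (@PS_le _ _ _ (1 + `|xi|) _ PS_nat1) => n; rewrite /koebe_coef cabs_ofR cabs_nat.
have n0 : (0 : R) <= n%:R by [].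
rewrite normrM normr_nat mulrC ler_wpM2r //.
apply: le_trans (ler_normD _ _) _; rewrite normr1 normrM normr_nat -nat1r.
by have := normr_ge0 xi; nra.
Qed.

Lemma ps_koebe_coefE xi z : cabs z < 1 -> ps (koebe_coef xi) z =
  ofR (1 - xi) * ps (fun n => n.+1%:R) z + ofR xi * ps (fun n => n.+1%:R ^+ 2) z.
Proof.
move=> z1; have h1 := PS_nat1; have h2 := PS_nat1sq.
rewrite -!ps_scale // -ps_add //; try exact: PS_scale.
apply: eq_ps => n; rewrite /koebe_coef -ofR_nat -ofRX -!ofRM -ofRD; congr ofR.
by rewrite -nat1r; ring.
Qed.

Lemma ps_koebe_coef xi (t : R) : 0 <= t < 1 -> complex.Re (ps (koebe_coef xi) (ofR (- t))) =
  (1 - xi) * (1 / (1 + t) ^+ 2) + xi * ((1 - t) / (1 + t) ^+ 3).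
Proof.
move=> /andP[t0 t1].
have z1 : cabs (ofR (- t)) < 1 by rewrite cabs_ofR normrN ger0_norm.
have p0 : 1 + t != 0 by rewrite gt_eqF // ltr_wpDr.
rewrite ps_koebe_coefE //.
have E : 1 - ofR (- t) = ofR (1 + t) by rewrite ofRN opprK ofRD ofR1.
have h1 := ps_nat1 z1; have h2 := ps_nat1sq z1; rewrite E -!ofRX in h1 h2.
have q n : ofR ((1 + t) ^+ n) != 0 by rewrite -cabs_eq0 cabs_ofR normr_eq0 expf_neq0.
have -> : ps (fun n => n.+1%:R) (ofR (- t)) = ofR (1 / (1 + t) ^+ 2).
  by apply: (mulfI (q 2)); rewrite h1 -ofRM mulrC divfK // expf_neq0.
have -> : ps (fun n => n.+1%:R ^+ 2) (ofR (- t)) = ofR ((1 - t) / (1 + t) ^+ 3).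
  by apply: (mulfI (q 3)); rewrite h2 -ofRM mulrC divfK ?expf_neq0 // ofRB ofR1 ofRN.
by rewrite ReD !ReZ.
Qed.

Lemma ps_koebe_coef_bound xi (t : R) : 0 <= xi <= 1 -> 0 <= t < 1 ->
  `|complex.Re (ps (koebe_coef xi) (ofR (- t)))| <= 1.
Proof.
move=> /andP[x0 x1] t01; have [t0 t1] := andP t01; rewrite ps_koebe_coef //.
have a0 n : 0 < ((1 + t) ^+ n)^-1 by rewrite invr_gt0 exprn_gt0 // ltr_wpDr.
have a1 n : ((1 + t) ^+ n)^-1 <= 1.
  by rewrite invf_le1 ?exprn_gt0 ?ltr_wpDr // exprn_ege1 // lerDl.
move: (a0 2) (a1 2) (a0 3) (a1 3); rewrite mul1r.
set p := (_ ^+ 2)^-1; set q := (_ ^+ 3)^-1 => p0 p1 q0 q1.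
have k0 : 0 <= (1 - t) * q by rewrite mulr_ge0 ?(ltW q0) // subr_ge0 ltW.
have k1 : (1 - t) * q <= 1 by nra.
have x2 : 0 <= 1 - xi by rewrite subr_ge0.
rewrite ger0_norm; last by apply: addr_ge0; apply: mulr_ge0 => //; exact: ltW.
have l1 : (1 - xi) * p <= (1 - xi) * 1 by rewrite ler_wpM2l.
have l2 : xi * ((1 - t) * q) <= xi * 1 by rewrite ler_wpM2l.
by have := lerD l1 l2; rewrite !mulr1 subrK.
Qed.

(** Abel summation: (1 + t) times the sum is e_0 - t times the series of the
    differences of e, and the latter is bounded by their total variation. *)
Lemma ps_bounded_var (e : nat -> R) (C : R) : PS (fun n => ofR (e n)) ->
  (forall n, \sum_(0 <= k < n) `|e k.+1 - e k| <= C) ->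
  forall t : R, 0 <= t < 1 -> `|complex.Re (ps (fun n => ofR (e n)) (ofR (- t)))| <= `|e 0| + C.
Proof.
move=> he hC t /andP[t0 t1].
set z := ofR (- t); set S := complex.Re _.
have z1 : cabs z < 1 by rewrite cabs_ofR normrN ger0_norm.
pose D n : Cplx R := ofR (e n.+1) - ofR (e n).
have cD : cabs (ps D z) <= C.
  pose b k := `|e k.+1 - e k|.
  have nd : nondecreasing_seq (series b) by apply: nondecreasing_series => k _ _; exact: normr_ge0.
  have cb : cvgn (series b).
    by apply: nondecreasing_is_cvgn => //; exists C => _ [n _ <-]; exact: hC.
  apply: (le_trans (ps_le _ cb)).
    move=> n; rewrite cabsM cabsX /D -ofRB cabs_ofR ler_piMr //.
    by rewrite exprn_ile1 ?cabs_ge0 // ltW.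
  by apply: limr_le => //; apply: nearW => n; exact: hC.
have E := ps_diff he z1.
have E1 : 1 - z = ofR (1 + t) by rewrite /z ofRN opprK ofRD ofR1.
have E2 : (1 + t) * S = e 0 + - t * complex.Re (ps D z).
  by have := congr1 (@complex.Re R) E; rewrite E1 ReZ ReD ReZ.
have S1 : `|S| <= (1 + t) * `|S| by rewrite ler_peMl // lerDl.
apply: (le_trans S1).
have -> : (1 + t) * `|S| = `|(1 + t) * S| by rewrite normrM [`|1 + t|]ger0_norm // addr_ge0.
rewrite E2; apply: le_trans (ler_normD _ _) _; rewrite lerD2l normrM normrN (ger0_norm t0).
apply: (@le_trans _ _ `|complex.Re (ps D z)|); last exact: le_trans (le_Re_cabs _) cD.
by rewrite ler_piMl // ltW.
Qed.

Definition linfrac (p q : R) n : R := (1 + p * n%:R) / (1 + q * n%:R).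

Lemma linfrac_bound p q n : 0 <= p -> 0 < q -> 0 <= linfrac p q n <= 1 + p / q.
Proof.
move=> p0 q0; have n0 : (0 : R) <= n%:R by [].
have d0 : 0 < 1 + q * n%:R by rewrite ltr_pwDl // mulr_ge0 // ltW.
have a0 : 0 <= 1 + p * n%:R by rewrite addr_ge0 // mulr_ge0.
rewrite divr_ge0 ?(ltW d0) //= ler_pdivrMr //.
have -> : (1 + p / q) * (1 + q * n%:R) = 1 + p * n%:R + (q * n%:R + p / q).
  by field; rewrite gt_eqF.
by rewrite lerDl addr_ge0 ?mulr_ge0 ?invr_ge0 // ltW.
Qed.

(** The increments are (p - q)/q times those of the decreasing function
    1/(1 + q n), and hence telescope in absolute value. *)
Lemma linfrac_var p q n : 0 < q ->
  \sum_(0 <= k < n) `|linfrac p q k.+1 - linfrac p q k| <= `|p - q| / q.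
Proof.
move=> q0; pose g k : R := (1 + q * k%:R)^-1.
have d0 k : 0 < 1 + q * k%:R by rewrite ltr_pwDl // mulr_ge0 // ltW.
have E k : `|linfrac p q k.+1 - linfrac p q k| = - (`|p - q| / q * (g k.+1 - g k)).
  have -> : linfrac p q k.+1 - linfrac p q k = (p - q) * (g k * g k.+1).
    rewrite /linfrac /g; have := d0 k.+1; rewrite -nat1r => d1.
    by field; rewrite !gt_eqF.
  rewrite normrM [`|g k * _|]ger0_norm; last by rewrite mulr_ge0 // invr_ge0 ltW.
  rewrite -mulrA -mulrN; congr (_ * _).
  rewrite /g; have := d0 k.+1; rewrite -nat1r => d1.
  by field; rewrite !gt_eqF.
under eq_bigr do rewrite E.
rewrite sumrN -mulr_sumr telescope_sumr // -mulrN opprB /g mulr0 addr0 invr1.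
have : 0 <= g n by rewrite invr_ge0 ltW.
rewrite -/(g n) => gn; rewrite ler_piMr ?divr_ge0 ?(ltW q0) //.
by rewrite gerBl.
Qed.

Lemma variation_mul (f g : nat -> R) (M N V W : R) n :
  (forall k, `|f k| <= M) -> (forall k, `|g k| <= N) ->
  (forall n, \sum_(0 <= k < n) `|f k.+1 - f k| <= V) ->
  (forall n, \sum_(0 <= k < n) `|g k.+1 - g k| <= W) ->
  \sum_(0 <= k < n) `|f k.+1 * g k.+1 - f k * g k| <= M * W + N * V.
Proof.
move=> fM gN fV gW.
have M0 : 0 <= M by exact: le_trans (normr_ge0 _) (fM 0).
have N0 : 0 <= N by exact: le_trans (normr_ge0 _) (gN 0).
apply: (@le_trans _ _ (M * (\sum_(0 <= k < n) `|g k.+1 - g k|) +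
   N * (\sum_(0 <= k < n) `|f k.+1 - f k|))).
  rewrite !mulr_sumr -big_split; apply: ler_sum => k _ /=.
  have -> : f k.+1 * g k.+1 - f k * g k = f k.+1 * (g k.+1 - g k) + g k * (f k.+1 - f k) by ring.
  apply: le_trans (ler_normD _ _) _; rewrite !normrM.
  by apply: lerD; rewrite ler_wpM2r.
by apply: lerD; rewrite ler_wpM2l.
Qed.

Variables (mu nu : R).
Hypotheses (hmu : 0 < mu) (hnu : 0 < nu).

(** The coefficients of (1-xi)(1+g)/2 + xi q, up to the sign (-1)^n. *)
Definition norm_coef (xi : R) n : R := n.+1%:R * (1 + xi * n%:R) / denom mu nu n.

Lemma norm_coefE xi n : norm_coef xi n = linfrac 1 mu n * linfrac xi nu n.
Proof. by rewrite /norm_coef /linfrac mulf_div -nat1r mul1r. Qed.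

(** A product of two bounded sequences of bounded variation.  The terms of the
    series do not tend to 0 at t = 1 when xi > 0, so this is what bounds its sum
    on [0, 1[. *)
Lemma norm_coef_var xi : 0 <= xi -> exists C, forall n,
  \sum_(0 <= k < n) `|norm_coef xi k.+1 - norm_coef xi k| <= C.
Proof.
move=> x0; eexists => n; under eq_bigr do rewrite !norm_coefE.
apply: variation_mul => k; last 2 first.
- exact: linfrac_var.
- exact: linfrac_var.
- by have /andP[a b] := @linfrac_bound 1 mu k ler01 hmu; rewrite ger0_norm //; exact: b.
- by have /andP[a b] := @linfrac_bound xi nu k x0 hnu; rewrite ger0_norm //; exact: b.
Qed.

Lemma PS_norm_coef xi : 0 <= xi -> PS (fun n => ofR (norm_coef xi n)).
Proof.
move=> x0; apply: (@PS_bounded _ _ ((1 + 1 / mu) * (1 + xi / nu))) => n.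
have /andP[a0 a1] := @linfrac_bound 1 mu n ler01 hmu.
have /andP[b0 b1] := @linfrac_bound xi nu n x0 hnu.
have e0 : 0 <= linfrac 1 mu n * linfrac xi nu n by rewrite mulr_ge0.
rewrite cabs_ofR norm_coefE ger0_norm //.
exact: (ler_pM a0 b0 a1 b1).
Qed.

Lemma ps_norm_coef_bound xi : 0 <= xi -> exists C, forall t : R, 0 <= t < 1 ->
  `|complex.Re (ps (fun n => ofR (norm_coef xi n)) (ofR (- t)))| <= C.
Proof.
move=> x0; have [C hC] := norm_coef_var x0; exists (`|norm_coef xi 0| + C) => t t01.
exact: (ps_bounded_var (PS_norm_coef x0) hC).
Qed.

End Kernels.

(** * The integral N and the operator V *)

Section Assembly.
Variable R : realType.
Notation leb := (@lebesgue_measure R).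
Notation I01 := (`[(0:R), (1:R)]%classic).

Lemma eq_integral_bndo (f g : R -> R) : measurable_fun I01 g ->
  (forall t, 0 <= t < 1 -> f t = g t) ->
  (\int[leb]_(t in I01) (f t)%:E = \int[leb]_(t in I01) (g t)%:E)%E.
Proof.
move=> mg fg.
have sub : (`[(0:R), (1:R)[%classic `<=` I01) by apply: subset_itvl; rewrite bnd_simp.
have mg' : measurable_fun `[(0:R), (1:R)[%classic (fun t => (g t)%:E).
  by apply/measurable_EFinP; exact: measurable_funS mg.
have mf' : measurable_fun `[(0:R), (1:R)[%classic (fun t => (f t)%:E).
  by apply: eq_measurable_fun mg' => t; rewrite inE /= in_itv /= => /fg ->.
rewrite -[LHS]integral_itv_bndo_bndc // -[RHS]integral_itv_bndo_bndc //.
by apply: eq_integral => t; rewrite inE /= in_itv /= => /fg ->.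
Qed.

Variables (mu nu xi : R) (lam : R -> R).
Hypotheses (hmu : 0 < mu) (hnu : 0 < nu) (hxi : 0 <= xi <= 1).
Hypothesis hlam0 : forall t : R, 0 <= t <= 1 -> 0 <= lam t.
Hypothesis hlami : leb.-integrable I01 (fun t : R => (lam t)%:E).
Hypothesis hlam1 : \int[leb]_(t in I01) lam t = 1.

Local Notation tau := (tau lam).
Local Notation kappa := (kappa mu nu lam).
Let x0 : 0 <= xi. Proof. by case/andP: hxi. Qed.

Let ikappa := integrable_kappa hmu hnu hlam0 hlami.

Let kappa_mom n : \int[leb]_(t in I01) (kappa t * t ^+ n) = mu * nu * (tau n / denom mu nu n).
Proof. by rewrite /Rintegral (kappa_moment hmu hnu hlam0 hlami). Qed.

Let r (j : nat) : R := 1 - j.+2%:R^-1.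

Let r01 j : 0 <= r j < 1.
Proof.
rewrite subr_ge0 invf_le1 ?ler1n //= /r gtrBl invr_gt0 //.
Qed.

Let r_cvg : r @ \oo --> (1 : R).
Proof.
rewrite -[X in _ --> X]subr0; apply: cvgB; first exact: cvg_cst.
by rewrite (cvg_shiftS (fun n => (n.+1%:R)^-1 : R)); exact: cvg_harmonic.
Qed.

(** Abel's theorem under the integral sign: termwise integration is legitimate at
    the radii r_j < 1, and the bound C dominates the passage to the limit. *)
Let abel_limit a (g : R -> R) (C : R) : PS a -> leb.-integrable I01 (fun t => (g t)%:E) ->
  (forall t, 0 <= t <= 1 -> 0 <= g t) ->
  (forall t, 0 <= t < 1 -> `|complex.Re (ps a (ofR (- t)))| <= C) ->
  leb.-integrable I01 (fun t => (g t * complex.Re (ps a (ofR (- t))))%:E) /\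
  complex.Re (ps (fun n => ofR (\int[leb]_(t in I01) (g t * t ^+ n)) * a n) (ofR (- r j)))
    @[j --> \oo] --> \int[leb]_(t in I01) (g t * complex.Re (ps a (ofR (- t)))).
Proof.
move=> ha ig g0 hC.
have z1 j : cabs (ofR (- r j)) < 1.
  by have /andP[a0 a1] := r01 j; rewrite cabs_ofR normrN ger0_norm.
pose f_ j t := g t * complex.Re (ps a (ofR t * ofR (- r j))).
have mf j : measurable_fun I01 (f_ j).
  by have [/integrableP[/measurable_EFinP]] := integral_ps ig ha (z1 j).
have cf t : 0 <= t < 1 -> f_ j t @[j --> \oo] --> g t * complex.Re (ps a (ofR (- t))).
  move=> /andP[t0 t1]; apply: cvgM; first exact: cvg_cst.
  apply: cvg_Re; apply: ps_cvg_comp => //; first by rewrite cabs_ofR normrN ger0_norm.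
  under eq_fun do rewrite -ofRM.
  apply: cvg_ofR; rewrite -[X in _ --> X]mulr1 mulNr -mulrN.
  by apply: cvgM; [exact: cvg_cst|apply: cvgN; exact: r_cvg].
have iC : leb.-integrable I01 (fun t => (C * g t)%:E).
  rewrite [X in integrable _ _ X](_ : _ = (fun t => C%:E * (g t)%:E)%E).
    by apply: integrableZl.
  by apply/funext => t; rewrite EFinM.
have dom j t : 0 <= t < 1 -> `|f_ j t| <= C * g t.
  move=> /andP[t0 t1]; have gt0 : 0 <= g t by rewrite g0 // t0 ltW.
  rewrite normrM (ger0_norm gt0) mulrC ler_wpM2r // -ofRM mulrN.
  have /andP[rj0 rj1] := r01 j.
  by apply: hC; rewrite mulr_ge0 //= mulr_ilt1.
have [iS cS] := dominated01 mf cf iC dom; split=> //.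
apply: eq_cvgn cS => j.
by have [_] := integral_ps ig ha (z1 j).
Qed.

(** At the radii r_j both sides have the same coefficients, as the moments of
    [kappa] are mu nu tau_n/((1 + mu n)(1 + nu n)). *)
Lemma integral_kappa_lam :
  leb.-integrable I01 (fun t => (kappa t * complex.Re (ps (koebe_coef xi) (ofR (- t))))%:E) /\
  leb.-integrable I01
    (fun t => (lam t * complex.Re (ps (fun n => ofR (norm_coef mu nu xi n)) (ofR (- t))))%:E) /\
  \int[leb]_(t in I01) (kappa t * complex.Re (ps (koebe_coef xi) (ofR (- t)))) =
  mu * nu * \int[leb]_(t in I01)
    (lam t * complex.Re (ps (fun n => ofR (norm_coef mu nu xi n)) (ofR (- t)))).
Proof.
have [C hC] := ps_norm_coef_bound hmu hnu x0.
have k0 t : 0 <= t <= 1 -> 0 <= kappa t by move=> /andP[t0 _]; exact: kappa_ge0.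
have [i1 c1] := abel_limit (PS_koebe_coef xi) ikappa k0 (fun t => @ps_koebe_coef_bound R xi t hxi).
have [i2 c2] := abel_limit (PS_norm_coef hmu hnu x0) hlami hlam0 hC.
split=> //; split=> //.
apply: (cvg_unique (@Rhausdorff R) c1).
apply: eq_cvgn (cvgM (cvg_cst (mu * nu)) c2) => j /=.
have z1 : cabs (ofR (- r j)) < 1.
  by have /andP[a0 a1] := r01 j; rewrite cabs_ofR normrN ger0_norm.
rewrite -ReZ -ps_scale //; last first.
  apply: PS_hadamard; last exact: PS_norm_coef.
  by apply: (@PS_bounded _ _ 1) => n; rewrite cabs_ofR;
     have /andP[a0 a1] := tau01 hlam0 hlami hlam1 n; rewrite ger0_norm.
congr (complex.Re _); apply: eq_ps => n; rewrite kappa_mom -/(tau n) /koebe_coef /norm_coef.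
by rewrite -!ofRM; congr ofR; ring.
Qed.

(** This is the meaning of the relation between beta and rho: it makes 1 - B the
    boundary value at z = -1 of the series of [dual_coef] for eps = 1, its
    constant term being replaced by 1. *)
Lemma normalization_integral :
  \int[leb]_(t in I01) (lam t * ((1 - xi) * ((1 - gfun mu nu t) / 2)
                    + xi * (1 - qfun mu nu t))) =
  1 - \int[leb]_(t in I01)
    (lam t * complex.Re (ps (fun n => ofR (norm_coef mu nu xi n)) (ofR (- t)))).
Proof.
have [_ [iS _]] := integral_kappa_lam.
have mS : measurable_fun I01 (fun t => lam t -
    lam t * complex.Re (ps (fun n => ofR (norm_coef mu nu xi n)) (ofR (- t)))).
  by apply: measurable_funB; apply/measurable_EFinP; [have /integrableP[] := hlami|have /integrableP[] := iS].
transitivity (\int[leb]_(t in I01) (lam t -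
    lam t * complex.Re (ps (fun n => ofR (norm_coef mu nu xi n)) (ofR (- t))))); last first.
  by rewrite RintegralB ?hlam1.
rewrite /Rintegral; congr fine; apply: eq_integral_bndo => // t t01.
have [t0 t1] := andP t01.
have z1 : cabs (ofR (- t)) < 1 by rewrite cabs_ofR normrN ger0_norm.
have rs x : 0 <= x -> limn (series (fun n => norm_coef mu nu x n * (- t) ^+ n)) =
    complex.Re (ps (fun n => ofR (norm_coef mu nu x n)) (ofR (- t))).
  move=> hx; apply/cvg_lim => //.
  apply: eq_cvgn (cvg_Re (ps_cvg (PS_norm_coef hmu hnu hx) z1)) => n.
  by rewrite /series /= Re_sum; apply: eq_bigr => k _; rewrite -ofRX ReZ.
have gE : gfun mu nu t = 2 * complex.Re (ps (fun n => ofR (norm_coef mu nu 0 n)) (ofR (- t))) - 1.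
  rewrite -rs // /gfun; congr (2 * _ - 1).
  apply: (f_equal (fun u : R^nat => limn (series u))); apply/funext => n.
  by rewrite /norm_coef /denom mul0r addr0 mulr1 [(- t) ^+ n]exprNn; ring.
have qE : qfun mu nu t = complex.Re (ps (fun n => ofR (norm_coef mu nu 1 n)) (ofR (- t))).
  rewrite -rs // /qfun.
  apply: (f_equal (fun u : R^nat => limn (series u))); apply/funext => n.
  by rewrite /norm_coef /denom mul1r nat1r [(- t) ^+ n]exprNn; ring.
rewrite gE qE.
have -> : complex.Re (ps (fun n => ofR (norm_coef mu nu xi n)) (ofR (- t))) =
  (1 - xi) * complex.Re (ps (fun n => ofR (norm_coef mu nu 0 n)) (ofR (- t))) +
  xi * complex.Re (ps (fun n => ofR (norm_coef mu nu 1 n)) (ofR (- t))).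
  have h0 := PS_norm_coef hmu hnu (lexx 0); have h1 := PS_norm_coef hmu hnu ler01.
  rewrite -!ReZ -ReD -!ps_scale // -ps_add //; try exact: PS_scale.
  congr (complex.Re _); apply: eq_ps => n; rewrite -!ofRM -ofRD; congr ofR.
  by rewrite /norm_coef; ring.
by field.
Qed.

Variable B : R.
Hypothesis hB : B = 1 - \int[leb]_(t in I01)
    (lam t * complex.Re (ps (fun n => ofR (norm_coef mu nu xi n)) (ofR (- t)))).

Local Notation dual_coef := (dual_coef xi mu nu B tau).

(** Both parts of the integrand are power series integrated against [kappa]: the
    first one termwise by [integral_ps], the second one through
    [integral_kappa_lam]. *)
Lemma Nfun_integral (eps z : Cplx R) : cabs z < 1 ->
  (\int[leb]_(t in I01)
    (t `^ (mu^-1 - 1) * Pi lam mu nu t *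
      ((1 - xi) * (complex.Re (overz (heps eps) (ofR t * z)) - 1 / (1 + t) ^+ 2)
       + xi * (complex.Re (derive1 (heps eps) (ofR t * z))
                - (1 - t) / (1 + t) ^+ 3)))%:E)%E =
  (mu * nu * (complex.Re (ps (dual_coef eps) z) - B))%:E.
Proof.
move=> z1; have hh := is_ps_heps eps; have hc := PS_heps_coef eps.
pose a n : Cplx R := ofR (1 + xi * n%:R) * heps_coef eps n.
have ha : PS a.
  apply: (@PS_le _ _ _ 1 _ hc) => n; rewrite /a cabsM ler_wpM2r ?cabs_ge0 // cabs_ofR mul1r.
  have n0 : (0 : R) <= n%:R by [].
  have /andP[_ x1] := hxi.
  rewrite ger0_norm ?addr_ge0 ?mulr_ge0 // -nat1r lerD2l.
  by rewrite ler_piMl.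
have [i1 e1] := integral_ps ikappa ha z1.
have [i2 [i3 e2]] := integral_kappa_lam.
transitivity (\int[leb]_(t in I01) (kappa t * complex.Re (ps a (ofR t * z)) -
    kappa t * complex.Re (ps (koebe_coef xi) (ofR (- t))))%:E)%E.
  apply: eq_integral_bndo.
    by apply: measurable_funB; apply/measurable_EFinP; [have /integrableP[] := i1|have /integrableP[] := i2].
  move=> t t01; have [t0 t1] := andP t01.
  have tz1 : cabs (ofR t * z) < 1 by apply: cabs_ray => //; rewrite t0 ltW.
  rewrite -/(kappa t) ps_koebe_coef // (overz_ps hh) //.
  have [_ dE] := is_ps_derive1 hh; rewrite dE //.
  have -> : ps a (ofR t * z) = ofR (1 - xi) * ps (fun n => zps (heps_coef eps) n.+1) (ofR t * z) +
     ofR xi * ps (dps (zps (heps_coef eps))) (ofR t * z).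
    have h1 := PS_d (proj1 hh).
    rewrite -!ps_scale // -ps_add //; try exact: PS_scale.
    apply: eq_ps => n; rewrite /a /dps /= mulrA -mulrDl -ofR_nat -ofRM -ofRD.
    by congr (ofR _ * _); rewrite -nat1r; ring.
  by rewrite ReD !ReZ; ring.
have iB : leb.-integrable I01 (fun t => (kappa t * complex.Re (ps a (ofR t * z)) -
    kappa t * complex.Re (ps (koebe_coef xi) (ofR (- t))))%:E).
  by apply: (integrableB _ i1 i2).
rewrite -[LHS]fineK; last by apply: integrable_fin_num.
congr EFin; rewrite -/(Rintegral _ _ _) RintegralB // e1 e2.
have -> : \int[leb]_(t in I01)
    (lam t * complex.Re (ps (fun n => ofR (norm_coef mu nu xi n)) (ofR (- t)))) = 1 - B.
  by rewrite hB; ring.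
pose k n : Cplx R := ofR (tau n * (1 + xi * n%:R) / denom mu nu n) * heps_coef eps n.
have hKt := PS_dual_coef B hxi hmu hnu (tau01 hlam0 hlami hlam1) eps.
have KE : dual_coef eps =1 fun n => k n + ofR (2 * B - 1) * delta0 R n.
  move=> n; rewrite /dual_coef /k /delta0; case: n => [|n] /=; last by rewrite mulr0 addr0.
  rewrite tau0 // mulr0 addr0 denom0 mul1r divr1 ofR1 mul1r mulr1 /heps_coef mulr0 addr0.
  by rewrite -ofR1 -ofRD; congr ofR; ring.
have hk : PS k.
  have := PS_add hKt (PS_scale (- ofR (2 * B - 1)) (@PS_delta0 R)).
  congr PS; apply/funext => n; rewrite KE mulNr addrK //.
rewrite (eq_ps _ KE) ps_add //; last by apply: PS_scale; exact: PS_delta0.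
rewrite ps_scale //; last exact: PS_delta0.
rewrite ps_delta0 mulr1 ReD /=.
have -> : ps (fun n => ofR (\int[leb]_(t in I01) (kappa t * t ^+ n)) * a n) z =
    ofR (mu * nu) * ps k z.
  rewrite -ps_scale //; apply: eq_ps => n; rewrite kappa_mom /a /k !mulrA -!ofRM.
  by congr (ofR _ * _); ring.
by rewrite ReZ; ring.
Qed.

Lemma Nfun_ge0 (eps : Cplx R) : (0 <= Nfun lam mu nu xi (heps eps))%E <->
  forall z, cabs z < 1 -> B <= complex.Re (ps (dual_coef eps) z).
Proof.
have mn0 : 0 < mu * nu by rewrite mulr_gt0.
split=> [H z z1|H].
  have : (0 <= (mu * nu * (complex.Re (ps (dual_coef eps) z) - B))%:E)%E.
    rewrite -Nfun_integral //; apply: le_trans H _; apply: ereal_inf_lbound.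
    by exists z => //=; rewrite ltR_norm1.
  by rewrite lee_fin pmulr_rge0 // subr_ge0.
apply: le_ereal_inf_tmp => _ [z /= z1 <-]; rewrite ltR_norm1 in z1.
by rewrite Nfun_integral // lee_fin pmulr_rge0 // subr_ge0 H.
Qed.

(** (1 - rho u)/(1 - u) = 1 + (1 - rho)(u + u^2 + ...) is integrated termwise
    against [lam], its imaginary part being the real part of -i times it. *)
Lemma is_ps_Vop (rho : R) f a : is_ps f a ->
  is_ps (Vop lam rho f) (fun n => kernel_coef rho tau n * a n).
Proof.
move=> fa.
pose g n : Cplx R := ofR (1 - rho) + ofR rho * delta0 R n.
have h1 : PS (fun _ => ofR (1 - rho)) by exact: (@PS_bounded _ _ (cabs (ofR (1 - rho)))).
have hd : PS (fun n => ofR rho * delta0 R n) by apply: PS_scale; exact: PS_delta0.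
have hg : PS g by exact: PS_add.
have ht : PS (fun n => ofR (tau n)).
  apply: (@PS_bounded _ _ 1) => n; rewrite cabs_ofR.
  by have /andP[a0 a1] := tau01 hlam0 hlami hlam1 n; rewrite ger0_norm.
have htg : PS (fun n => ofR (tau n) * g n) by exact: PS_hadamard.
have gE u : cabs u < 1 -> ps g u = (1 - ofR rho * u) / (1 - u).
  move=> u1; have u0 := neq1_disk u1; apply: (mulIf u0); rewrite divfK // mulrC ps_add //.
  rewrite mulrDr ps_cst // ps_scale //; last exact: PS_delta0.
  by rewrite ps_delta0 mulr1 ofRB ofR1; ring.
pose G z : Cplx R := cintegral `[0, 1] (fun t =>
       ofR (lam t) * ((1 - ofR (rho * t) * z) / (1 - ofR t * z))).
have GE z : cabs z < 1 -> G z = ps (fun n => ofR (tau n) * g n) z.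
  move=> z1.
  have E t : t \in I01 -> (1 - ofR (rho * t) * z) / (1 - ofR t * z) = ps g (ofR t * z).
    rewrite inE /= in_itv /= => t01; rewrite gE; last exact: cabs_ray.
    by rewrite ofRM mulrA.
  apply: eq_Cplx => /=.
    have [_ <-] := integral_ps hlami hg z1.
    by apply: eq_Rintegral => t t01; rewrite E // ReZ.
  (* Im w = Re (- i w) *)
  pose c : Cplx R := Complex 0 (-1).
  have ReI w : complex.Re (c * w) = complex.Im w by rewrite ReM /=; ring.
  have hcg : PS (fun n => c * g n) by exact: PS_scale.
  have [_ e] := integral_ps hlami hcg z1.
  rewrite -ReI -ps_scale // (@eq_ps _ _ (fun n => ofR (tau n) * (c * g n))); last first.
    by move=> n; rewrite mulrCA.
  rewrite -e; apply: eq_Rintegral => t t01; rewrite E // ImZ ps_scale ?ReI //.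
  by apply: cabs_ray => //; move: t01; rewrite inE /= in_itv.
have hK : is_ps (fun z => z * G z) (kernel_coef rho tau).
  apply: eq_is_ps (is_ps_mulz (is_ps_id htg)).
    by move=> z z1; rewrite GE.
  move=> [|[|n]] //=; rewrite /g /delta0 /=.
    by rewrite tau0 // ofR1 mul1r mulr1 -ofRD subrK ofR1.
  by rewrite mulr0 addr0 -ofRM mulrC.
split; first by apply: PS_hadamard; [have [] := hK|have [] := fa].
move=> z z1; rewrite /Vop /hadamard (taylor_coef_ps hK) (taylor_coef_ps fa).
by rewrite ps.unlock.
Qed.

End Assembly.

Unset Implicit Arguments.

Theorem theorem4p1 (R : realType) (alpha gamma xi mu nu rho beta : R)
    (lam : R -> R)
    (halpha : 0 <= alpha) (hgamma : 0 < gamma) (hxi : 0 <= xi <= 1)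
    (hmu : 0 < mu) (hnu : 0 < nu)
    (hsum : mu + nu = alpha - gamma) (hprod : mu * nu = gamma)
    (hlam0 : forall t : R, 0 <= t <= 1 -> 0 <= lam t)
    (hlami : lebesgue_measure.-integrable `[0, 1] (fun t : R => (lam t)%:E))
    (hlam1 : \int[lebesgue_measure]_(t in `[0, 1]) lam t = 1)
    (hrho : rho < 1) (hbeta : beta < 1)
    (hbr : 1 / (2 * (1 - beta) * (1 - rho)) =
       \int[lebesgue_measure]_(t in `[0, 1])
         (lam t * ((1 - xi) * ((1 - gfun mu nu t) / 2)
                    + xi * (1 - qfun mu nu t)))) :
  (forall f : Cplx R -> Cplx R,
     classW beta alpha gamma f -> pascu xi (Vop lam rho f))
  <->
  (forall eps : Cplx R, `|eps| = 1 ->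
     (0 <= Nfun lam mu nu xi (heps eps))%E).
Proof.
rewrite (normalization_integral hmu hnu hxi hlam0 hlami hlam1) in hbr.
pose B := 1 / (2 * (1 - beta) * (1 - rho)).
have hB : B * (2 * (1 - beta) * (1 - rho)) = 1.
  by rewrite /B divfK // !mulf_neq0 // gt_eqF // subr_gt0.
have htau := tau01 hlam0 hlami hlam1.
have hV f a (fa : is_ps f a) : is_ps (Vop lam rho f) (fun n => kernel_coef rho (tau lam) n * a n) :=
  is_ps_Vop hlam0 hlami hlam1 rho fa.
have N0 eps := Nfun_ge0 hmu hnu hxi hlam0 hlami hlam1 hbr eps.
have unit eps : `|eps| = 1 <-> cabs eps = 1.
  by rewrite normE; split=> [h|-> //]; apply: ofR_inj; rewrite h.
split=> [H eps /unit eps1|H f].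
  by apply/N0 => z z1; exact: (pascu_dual_halfplane hxi hmu hnu hsum hprod hrho hbeta hB htau hV H eps1).
apply: (dual_halfplane_pascu hxi hmu hnu hsum hprod hrho hbeta hB htau hV).
by move=> eps /unit/H/N0 hN z z1; exact: hN.
Qed.
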